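(* Let $A,B\in\mathcal V$ be such that $d(A)=m$ and $d(B)=n$, and let $f$ be a closed proof-term of $A\multimap B$. Then the function $F$ from $\mathcal S^m$ to $\mathcal S^n$ defined by $F(\mathbf u)=\underline{f\,\overline{\mathbf u}^A}$ is linear (i.e. $F(\mathbf u+\mathbf v)=F(\mathbf u)+F(\mathbf v)$ and $F(a\mathbf u)=aF(\mathbf u)$ for all $\mathbf u,\mathbf v\in\mathcal S^m$, $a\in\mathcal S$).
   Context: The $\mathcal L_!^{\mathcal S}$-calculus. Let $\mathcal S$ be a commutative semiring, whose elements are called scalars. Propositions are generated by $A ::= \mathfrak 1\mid A\multimap A\mid A\otimes A\mid\top\mid\mathfrak 0\mid A\mathbin{\&}A\mid A\oplus A\mid {!}A$. Proof-terms, taken modulo $\alpha$-equivalence, are generated by (with $a\in\mathcal S$) $t ::= x\mid t\boxplus u\mid a\bullet t\mid a.\star\mid\delta_{\mathfrak 1}(t,u)\mid\lambda x^A.t\mid t\,u\mid t\otimes u\mid\delta_\otimes(t,x^Ay^B.u)\mid\langle\rangle\mid\delta_{\mathfrak 0}(t)\mid\langle t,u\rangle\mid\delta_{\&}^1(t,x^A.u)\mid\delta_{\&}^2(t,x^B.u)\mid\mathit{inl}(t)\mid\mathit{inr}(t)\mid\delta_\oplus(t,x^A.u,y^B.v)\mid {!}t\mid\delta_!(t,x^A.u)$. Variables before a dot are bound in the term after it; $(u/x)t$ is capture-avoiding substitution of $u$ for $x$ in $t$. Judgements $\Upsilon;\Gamma\vdash t:A$ have an intuitionistic context $\Upsilon$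 and a linear context $\Gamma$ (finite sets of typed variables; $\Gamma,\Delta$ is disjoint union). Typing rules: - $\Upsilon;x^A\vdash x:A$; and $\Upsilon,x^A;\varnothing\vdash x:A$. - If $\Upsilon;\Gamma\vdash t:A$ and $\Upsilon;\Gamma\vdash u:A$ then $\Upsilon;\Gamma\vdash t\boxplus u:A$. If $\Upsilon;\Gamma\vdash t:A$ then $\Upsilon;\Gamma\vdash a\bullet t:A$. - $\Upsilon;\varnothing\vdash a.\star:\mathfrak 1$. If $\Upsilon;\Gamma\vdash t:\mathfrak 1$ and $\Upsilon;\Delta\vdash u:A$ then $\Upsilon;\Gamma,\Delta\vdash\delta_{\mathfrak 1}(t,u):A$. - If $\Upsilon;\Gamma,x^A\vdash t:B$ then $\Upsilon;\Gamma\vdash\lambda x^A.t:A\multimap B$. If $\Upsilon;\Gamma\vdash t:A\multimap B$ and $\Upsilon;\Delta\vdash u:A$ then $\Upsilon;\Gamma,\Delta\vdash t\,u:B$. - If $\Upsilon;\Gamma\vdash t:A$ and $\Upsilon;\Delta\vdash u:B$ then $\Upsilon;\Gamma,\Delta\vdash t\otimes u:A\otimes B$. If $\Upsilon;\Gamma\vdash t:A\otimes B$ and $\Upsilon;\Delta,x^A,y^B\vdash u:C$ then $\Upsilon;\Gamma,\Delta\vdash\delta_\otimes(t,x^Ay^B.u):C$. - $\Upsilon;\Gamma\vdash\langle\rangle:\top$. If $\Upsilon;\Gamma\vdash t:\mathfrak 0$ then $\Upsilon;\Gamma,\Delta\vdash\delta_{\mathfrak 0}(t):C$. - If $\Upsilon;\Gamma\vdash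 t:A$ and $\Upsilon;\Gamma\vdash u:B$ then $\Upsilon;\Gamma\vdash\langle t,u\rangle:A\mathbin{\&}B$. If $\Upsilon;\Gamma\vdash t:A\mathbin{\&}B$ and $\Upsilon;\Delta,x^A\vdash u:C$ (resp. $\Upsilon;\Delta,x^B\vdash u:C$) then $\Upsilon;\Gamma,\Delta\vdash\delta_{\&}^1(t,x^A.u):C$ (resp. $\delta_{\&}^2(t,x^B.u):C$). - If $\Upsilon;\Gamma\vdash t:A$ (resp. $t:B$) then $\Upsilon;\Gamma\vdash\mathit{inl}(t):A\oplus B$ (resp. $\mathit{inr}(t):A\oplus B$). If $\Upsilon;\Gamma\vdash t:A\oplus B$, $\Upsilon;\Delta,x^A\vdash u:C$ and $\Upsilon;\Delta,y^B\vdash v:C$ then $\Upsilon;\Gamma,\Delta\vdash\delta_\oplus(t,x^A.u,y^B.v):C$. - If $\Upsilon;\varnothing\vdash t:A$ then $\Upsilon;\varnothing\vdash {!}t:{!}A$. If $\Upsilon;\Gamma\vdash t:{!}A$ and $\Upsilon,x^A;\Delta\vdash u:B$ then $\Upsilon;\Gamma,\Delta\vdash\delta_!(t,x^A.u):B$. Reduction $\longrightarrow$ is the closure under arbitrary term contexts of: $\delta_{\mathfrak 1}(a.\star,t)\to a\bullet t$; $(\lambda x^A.t)\,u\to(u/x)t$; $\delta_\otimes(u\otimes v,x^Ay^B.w)\to(u/x,v/y)w$; $\delta_{\&}^i(\langle t_1,t_2\rangle,x^A.v)\to(t_i/x)v$ ($i=1,2$); $\delta_\oplus(\mathit{inl}(t),x^A.v,y^B.w)\to(t/x)v$;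 $\delta_\oplus(\mathit{inr}(u),x^A.v,y^B.w)\to(u/y)w$; $\delta_!({!}t,x^A.u)\to(t/x)u$; $a.\star\boxplus b.\star\to(a+b).\star$; $(\lambda x^A.t)\boxplus(\lambda x^A.u)\to\lambda x^A.(t\boxplus u)$; $\delta_\otimes(t\boxplus u,x^Ay^B.v)\to\delta_\otimes(t,x^Ay^B.v)\boxplus\delta_\otimes(u,x^Ay^B.v)$; $\langle\rangle\boxplus\langle\rangle\to\langle\rangle$; $\langle t,u\rangle\boxplus\langle v,w\rangle\to\langle t\boxplus v,u\boxplus w\rangle$; $\delta_\oplus(t\boxplus u,x^A.v,y^B.w)\to\delta_\oplus(t,x^A.v,y^B.w)\boxplus\delta_\oplus(u,x^A.v,y^B.w)$; $\delta_!(t\boxplus u,x^A.v)\to\delta_!(t,x^A.v)\boxplus\delta_!(u,x^A.v)$; $a\bullet b.\star\to(a\times b).\star$; $a\bullet\lambda x^A.t\to\lambda x^A.a\bullet t$; $\delta_\otimes(a\bullet t,x^Ay^B.v)\to a\bullet\delta_\otimes(t,x^Ay^B.v)$; $a\bullet\langle\rangle\to\langle\rangle$; $a\bullet\langle t,u\rangle\to\langle a\bullet t,a\bullet u\rangle$; $\delta_\oplus(a\bullet t,x^A.v,y^B.w)\to a\bullet\delta_\oplus(t,x^A.v,y^B.w)$; $\delta_!(a\bullet t,x^A.v)\to a\bullet\delta_!(t,x^A.v)$. Well-typed proof-terms are strongly normalising and confluent for $\longrightarrow$, so each has a unique irreducible form. A closed proof-term of $A$ is a $t$ with $\varnothing;\varnothing\vdash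 t:A$. The set $\mathcal V$ of propositions is defined inductively: $\mathfrak 1\in\mathcal V$, and if $A,B\in\mathcal V$ then $A\mathbin{\&}B\in\mathcal V$. The dimension is $d(\mathfrak 1)=1$, $d(B\mathbin{\&}C)=d(B)+d(C)$. For $A\in\mathcal V$ with $d(A)=n$: - To a closed irreducible proof-term $t$ of $A$ associate $\underline t\in\mathcal S^n$: if $A=\mathfrak 1$ then $t=a.\star$ and $\underline t=(a)$; if $A=A_1\mathbin{\&}A_2$ then $t=\langle u,v\rangle$ and $\underline t$ is the concatenation of the blocks $\underline u$ and $\underline v$. For an arbitrary closed proof-term $t$ of $A$, $\underline t:=\underline{t'}$ where $t'$ is the irreducible form of $t$. - To $\mathbf u\in\mathcal S^n$ associate a closed irreducible proof-term $\overline{\mathbf u}^A$ of $A$: if $n=1$ and $\mathbf u=(a)$, $\overline{\mathbf u}^A=a.\star$; if $n>1$, $A=A_1\mathbin{\&}A_2$, and $\mathbf u$ has blocks $\mathbf u_1,\mathbf u_2$ of lengths $d(A_1),d(A_2)$, then $\overline{\mathbf u}^A=\langle\overline{\mathbf u_1}^{A_1},\overline{\mathbf u_2}^{A_2}\rangle$. *)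

(* Defs.v *)
From HB Require Import structures.
From mathcomp Require Import all_boot all_algebra.
From Stdlib Require Import Relation_Operators ClassicalEpsilon.

Set Implicit Arguments.
Unset Strict Implicit.
Unset Printing Implicit Defensive.

Import GRing.Theory.
Local Open Scope ring_scope.

Inductive proposition : Type :=
| One
| Lolli of proposition & proposition
| Tensor of proposition & proposition
| Top
| Zero
| With of proposition & proposition
| Plus of proposition & proposition
| Bang of proposition.

(* Proof-terms modulo alpha-equivalence, with de Bruijn indices. There is a
   single index space for linear and intuitionistic variables. The type
   annotation of a bound variable comes just before the scope of the variable.
   [LetTensor t A B u] is delta_tensor(t, x^A y^B. u), which binds two variables
   in [u]: index 1 is x and index 0 is y. *)
Inductive term (S : Type) : Type :=
| Var of nat
| Sum of term S & term S
| Scal of S & term S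
| Star of S
| LetOne of term S & term S
| Lam of proposition & term S
| App of term S & term S
| TPair of term S & term S
| LetTensor of term S & proposition & proposition & term S
| Unit
| Absurd of term S
| WPair of term S & term S
| LetFst of term S & proposition & term S
| LetSnd of term S & proposition & term S
| Inl of term S
| Inr of term S
| Case of term S & proposition & term S & proposition & term S
| Promote of term S
| LetBang of term S & proposition & term S.

Arguments Var {S}.
Arguments Unit {S}.

Definition up_ren (r : nat -> nat) (i : nat) : nat :=
  if i is j.+1 then (r j).+1 else 0%N.

Fixpoint rename S (r : nat -> nat) (t : term S) : term S :=
  match t with
  | Var i => Var (r i)
  | Sum t u => Sum (rename r t) (rename r u)
  | Scal a t => Scal a (rename r t)
  | Star a => Star a
  | LetOne t u => LetOne (rename r t) (rename r u)
  | Lam A t => Lam A (rename (up_ren r) t)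
  | App t u => App (rename r t) (rename r u)
  | TPair t u => TPair (rename r t) (rename r u)
  | LetTensor t A B u =>
      LetTensor (rename r t) A B (rename (up_ren (up_ren r)) u)
  | Unit => Unit
  | Absurd t => Absurd (rename r t)
  | WPair t u => WPair (rename r t) (rename r u)
  | LetFst t A u => LetFst (rename r t) A (rename (up_ren r) u)
  | LetSnd t A u => LetSnd (rename r t) A (rename (up_ren r) u)
  | Inl t => Inl (rename r t)
  | Inr t => Inr (rename r t)
  | Case t A u B v =>
      Case (rename r t) A (rename (up_ren r) u) B (rename (up_ren r) v)
  | Promote t => Promote (rename r t)
  | LetBang t A u => LetBang (rename r t) A (rename (up_ren r) u)
  end.

Definition scons T (x : T) (s : nat -> T) (i : nat) : T :=
  if i is j.+1 then s j else x.

Definition up_subst S (s : nat -> term S) : nat -> term S :=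
  scons (Var 0) (fun i => rename succn (s i)).

Fixpoint subst S (s : nat -> term S) (t : term S) : term S :=
  match t with
  | Var i => s i
  | Sum t u => Sum (subst s t) (subst s u)
  | Scal a t => Scal a (subst s t)
  | Star a => Star a
  | LetOne t u => LetOne (subst s t) (subst s u)
  | Lam A t => Lam A (subst (up_subst s) t)
  | App t u => App (subst s t) (subst s u)
  | TPair t u => TPair (subst s t) (subst s u)
  | LetTensor t A B u =>
      LetTensor (subst s t) A B (subst (up_subst (up_subst s)) u)
  | Unit => Unit
  | Absurd t => Absurd (subst s t)
  | WPair t u => WPair (subst s t) (subst s u)
  | LetFst t A u => LetFst (subst s t) A (subst (up_subst s) u)
  | LetSnd t A u => LetSnd (subst s t) A (subst (up_subst s) u)
  | Inl t => Inl (subst s t)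
  | Inr t => Inr (subst s t)
  | Case t A u B v =>
      Case (subst s t) A (subst (up_subst s) u) B (subst (up_subst s) v)
  | Promote t => Promote (subst s t)
  | LetBang t A u => LetBang (subst s t) A (subst (up_subst s) u)
  end.

(* [subst1 u t] is (u/x)t; [subst2 u v w] is (u/x, v/y)w. *)
Definition subst1 S (u t : term S) : term S := subst (scons u Var) t.
Definition subst2 S (u v w : term S) : term S :=
  subst (scons v (scons u Var)) w.

(* A context is a finite partial map from indices to propositions. In a
   judgement both contexts range over the same index space; passing under a
   binder puts the new index 0 in exactly one of them. *)
Definition ctx := seq (option proposition).

Definition lookup (G : ctx) (i : nat) : option proposition := nth None G i.

Definition is_empty (G : ctx) : Prop := forall i, lookup G i = None.

Definition is_single (G : ctx) (i : nat) (A : proposition) : Prop :=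
  lookup G i = Some A /\ forall j, j != i -> lookup G j = None.

(* [T] is the disjoint union of [G] and [D]. *)
Definition disj_union (T G D : ctx) : Prop :=
  forall i, (lookup T i = lookup G i /\ lookup D i = None)
         \/ (lookup T i = lookup D i /\ lookup G i = None).

(* [typed Y G t A] is the judgement Y; G |- t : A. *)
Inductive typed (S : Type) : ctx -> ctx -> term S -> proposition -> Prop :=
| T_lvar Y G i A : is_single G i A -> typed Y G (Var i) A
| T_ivar Y G i A : lookup Y i = Some A -> is_empty G -> typed Y G (Var i) A
| T_sum Y G t u A : typed Y G t A -> typed Y G u A -> typed Y G (Sum t u) A
| T_scal Y G a t A : typed Y G t A -> typed Y G (Scal a t) A
| T_star Y G a : is_empty G -> typed Y G (Star a) One
| T_letone Y T G D t u A : disj_union T G D ->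
    typed Y G t One -> typed Y D u A -> typed Y T (LetOne t u) A
| T_lam Y G A t B :
    typed (None :: Y) (Some A :: G) t B -> typed Y G (Lam A t) (Lolli A B)
| T_app Y T G D t u A B : disj_union T G D ->
    typed Y G t (Lolli A B) -> typed Y D u A -> typed Y T (App t u) B
| T_tpair Y T G D t u A B : disj_union T G D ->
    typed Y G t A -> typed Y D u B -> typed Y T (TPair t u) (Tensor A B)
| T_lettensor Y T G D t A B u C : disj_union T G D ->
    typed Y G t (Tensor A B) ->
    typed (None :: None :: Y) (Some B :: Some A :: D) u C ->
    typed Y T (LetTensor t A B u) C
| T_unit Y G : typed Y G Unit Top
| T_absurd Y T G D t C : disj_union T G D ->
    typed Y G t Zero -> typed Y T (Absurd t) C
| T_wpair Y G t u A B :
    typed Y G t A -> typed Y G u B -> typed Y G (WPair t u) (With A B)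
| T_letfst Y T G D t A B u C : disj_union T G D ->
    typed Y G t (With A B) -> typed (None :: Y) (Some A :: D) u C ->
    typed Y T (LetFst t A u) C
| T_letsnd Y T G D t A B u C : disj_union T G D ->
    typed Y G t (With A B) -> typed (None :: Y) (Some B :: D) u C ->
    typed Y T (LetSnd t B u) C
| T_inl Y G t A B : typed Y G t A -> typed Y G (Inl t) (Plus A B)
| T_inr Y G t A B : typed Y G t B -> typed Y G (Inr t) (Plus A B)
| T_case Y T G D t A u B v C : disj_union T G D ->
    typed Y G t (Plus A B) ->
    typed (None :: Y) (Some A :: D) u C ->
    typed (None :: Y) (Some B :: D) v C ->
    typed Y T (Case t A u B v) C
| T_promote Y G t A : is_empty G ->
    typed Y G t A -> typed Y G (Promote t) (Bang A)
| T_letbang Y T G D t A u B : disj_union T G D ->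
    typed Y G t (Bang A) -> typed (Some A :: Y) (None :: D) u B ->
    typed Y T (LetBang t A u) B.

Definition closed_proof S (t : term S) (A : proposition) : Prop :=
  typed [::] [::] t A.

Inductive head_red (S : comPzSemiRingType) : term S -> term S -> Prop :=
| H_one a t : head_red (LetOne (Star a) t) (Scal a t)
| H_beta A t u : head_red (App (Lam A t) u) (subst1 u t)
| H_tensor u v A B w :
    head_red (LetTensor (TPair u v) A B w) (subst2 u v w)
| H_fst t1 t2 A v : head_red (LetFst (WPair t1 t2) A v) (subst1 t1 v)
| H_snd t1 t2 A v : head_red (LetSnd (WPair t1 t2) A v) (subst1 t2 v)
| H_inl t A v B w : head_red (Case (Inl t) A v B w) (subst1 t v)
| H_inr u A v B w : head_red (Case (Inr u) A v B w) (subst1 u w)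
| H_bang t A u : head_red (LetBang (Promote t) A u) (subst1 t u)
| H_sum_star a b : head_red (Sum (Star a) (Star b)) (Star (a + b))
| H_sum_lam A t u : head_red (Sum (Lam A t) (Lam A u)) (Lam A (Sum t u))
| H_sum_tensor t u A B v :
    head_red (LetTensor (Sum t u) A B v)
             (Sum (LetTensor t A B v) (LetTensor u A B v))
| H_sum_unit : head_red (Sum Unit Unit) Unit
| H_sum_pair t u v w :
    head_red (Sum (WPair t u) (WPair v w)) (WPair (Sum t v) (Sum u w))
| H_sum_case t u A v B w :
    head_red (Case (Sum t u) A v B w) (Sum (Case t A v B w) (Case u A v B w))
| H_sum_bang t u A v :
    head_red (LetBang (Sum t u) A v) (Sum (LetBang t A v) (LetBang u A v))
| H_scal_star a b : head_red (Scal a (Star b)) (Star (a * b))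
| H_scal_lam a A t : head_red (Scal a (Lam A t)) (Lam A (Scal a t))
| H_scal_tensor a t A B v :
    head_red (LetTensor (Scal a t) A B v) (Scal a (LetTensor t A B v))
| H_scal_unit a : head_red (Scal a Unit) Unit
| H_scal_pair a t u :
    head_red (Scal a (WPair t u)) (WPair (Scal a t) (Scal a u))
| H_scal_case a t A v B w :
    head_red (Case (Scal a t) A v B w) (Scal a (Case t A v B w))
| H_scal_bang a t A v :
    head_red (LetBang (Scal a t) A v) (Scal a (LetBang t A v)).

Inductive red (S : comPzSemiRingType) : term S -> term S -> Prop :=
| R_head t t' : head_red t t' -> red t t'
| R_sum1 t t' u : red t t' -> red (Sum t u) (Sum t' u)
| R_sum2 t u u' : red u u' -> red (Sum t u) (Sum t u')
| R_scal a t t' : red t t' -> red (Scal a t) (Scal a t')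
| R_letone1 t t' u : red t t' -> red (LetOne t u) (LetOne t' u)
| R_letone2 t u u' : red u u' -> red (LetOne t u) (LetOne t u')
| R_lam A t t' : red t t' -> red (Lam A t) (Lam A t')
| R_app1 t t' u : red t t' -> red (App t u) (App t' u)
| R_app2 t u u' : red u u' -> red (App t u) (App t u')
| R_tpair1 t t' u : red t t' -> red (TPair t u) (TPair t' u)
| R_tpair2 t u u' : red u u' -> red (TPair t u) (TPair t u')
| R_lettensor1 t t' A B u :
    red t t' -> red (LetTensor t A B u) (LetTensor t' A B u)
| R_lettensor2 t A B u u' :
    red u u' -> red (LetTensor t A B u) (LetTensor t A B u')
| R_absurd t t' : red t t' -> red (Absurd t) (Absurd t')
| R_wpair1 t t' u : red t t' -> red (WPair t u) (WPair t' u)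
| R_wpair2 t u u' : red u u' -> red (WPair t u) (WPair t u')
| R_letfst1 t t' A u : red t t' -> red (LetFst t A u) (LetFst t' A u)
| R_letfst2 t A u u' : red u u' -> red (LetFst t A u) (LetFst t A u')
| R_letsnd1 t t' A u : red t t' -> red (LetSnd t A u) (LetSnd t' A u)
| R_letsnd2 t A u u' : red u u' -> red (LetSnd t A u) (LetSnd t A u')
| R_inl t t' : red t t' -> red (Inl t) (Inl t')
| R_inr t t' : red t t' -> red (Inr t) (Inr t')
| R_case1 t t' A u B v : red t t' -> red (Case t A u B v) (Case t' A u B v)
| R_case2 t A u u' B v : red u u' -> red (Case t A u B v) (Case t A u' B v)
| R_case3 t A u B v v' : red v v' -> red (Case t A u B v) (Case t A u B v')
| R_promote t t' : red t t' -> red (Promote t) (Promote t')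
| R_letbang1 t t' A u : red t t' -> red (LetBang t A u) (LetBang t' A u)
| R_letbang2 t A u u' : red u u' -> red (LetBang t A u) (LetBang t A u').

Definition irreducible (S : comPzSemiRingType) (t : term S) : Prop :=
  forall t', ~ red t t'.

(* The irreducible form is selected by the choice operator. It is characterised
   by its specification because well-typed proof-terms are strongly normalising
   and confluent; the value is arbitrary on a term without irreducible form. *)
Definition normal_form (S : comPzSemiRingType) (t : term S) : term S :=
  epsilon (inhabits t)
    (fun t' => clos_refl_trans _ (@red S) t t' /\ irreducible t').

Inductive in_V : proposition -> Prop :=
| V_One : in_V One
| V_With A B : in_V A -> in_V B -> in_V (With A B).

(* [pdim], [vec_of_irr], [vec_of] and [term_of_vec] are only meaningful on
   propositions of V, and [vec_of_irr] only on closed irreducible proof-terms;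
   the other values are dummies. *)
Fixpoint pdim (A : proposition) : nat :=
  match A with
  | One => 1
  | With B C => pdim B + pdim C
  | _ => 0
  end%N.

Fixpoint vec_of_irr (S : comPzSemiRingType) (A : proposition) (t : term S) :
    'rV[S]_(pdim A) :=
  match A return 'rV[S]_(pdim A) with
  | One => if t is Star a then const_mx a else 0
  | With A1 A2 =>
      if t is WPair u v then row_mx (vec_of_irr A1 u) (vec_of_irr A2 v) else 0
  | _ => 0
  end.

Definition vec_of (S : comPzSemiRingType) (A : proposition) (t : term S) :
    'rV[S]_(pdim A) :=
  vec_of_irr A (normal_form t).

Fixpoint term_of_vec (S : comPzSemiRingType) (A : proposition) :
    'rV[S]_(pdim A) -> term S :=
  match A return 'rV[S]_(pdim A) -> term S with
  | One => fun u => Star (u 0 0)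
  | With A1 A2 => fun u =>
      WPair (term_of_vec (lsubmx u)) (term_of_vec (rsubmx u))
  | _ => fun _ => Unit
  end.

(* Main.v *)
Require Import Defs.
From HB Require Import structures.
From mathcomp Require Import all_boot all_algebra.
From Stdlib Require Import Relation_Operators ClassicalEpsilon.
From Stdlib Require Import FunctionalExtensionality.

(* Every proposition A is interpreted by a set of values, closed under formal
   linear combinations, together with a family of S-valued linear observations
   of these values; two terms are equivalent at A when they evaluate to values
   that no observation separates. Observing S-linearly turns the universal
   properties of the connectives into their definitions: an observation of
   A (x) B is a bilinear functional summed over the leaves of a value, one of !A
   is an arbitrary functional, one of A -o B evaluates at an argument. By
   induction on typing, a term respects equivalence in all its variables and is
   linear in those used linearly; in particular it evaluates to a value.
   Reduction preserves typing, hence equivalence, so all irreducible forms of a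
   closed term of a type in V are the vector read off by the observations, and
   that vector depends linearly on a linear argument. *)

Set Implicit Arguments.
Unset Strict Implicit.
Unset Printing Implicit Defensive.

Import GRing.Theory.
Local Open Scope ring_scope.

(** * Variables and substitution *)

(** The claim concerns scalars, but the induction crosses every proposition, and irreducible forms
    are too fine for it: no rule contracts a sum of two tensor pairs, so a term applied to a sum and
    the sum of its images need not share an irreducible form. A coarser equivalence is forced.
    Testing a value by all its eliminations into all propositions would not be a recursion on
    propositions, because the target of an elimination is arbitrary. Quantifying instead over all
    functionals into [S] of the right linearity breaks the circle: they only mention the components,
    and an elimination into [C] followed by an observation at [C] is always one of them. This
    pullback of observations is the adjoint attached to each elimination below. Linearity belongs to
    the very values of an implication, so it cannot be separated from termination: both come out of
    one induction. Evaluation is weak and leaves arguments and components untouched; full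
    irreducible forms are reached only at the end, for the propositions of V. *)

Fixpoint fv S (i : nat) (t : term S) : bool :=
  match t with
  | Var j => i == j
  | Star _ | Unit => false
  | Scal _ t | Absurd t | Inl t | Inr t | Promote t => fv i t
  | Sum t u | LetOne t u | App t u | TPair t u | WPair t u => fv i t || fv i u
  | Lam _ t => fv i.+1 t
  | LetTensor t _ _ u => fv i t || fv i.+2 u
  | LetFst t _ u | LetSnd t _ u | LetBang t _ u => fv i t || fv i.+1 u
  | Case t _ u _ v => [|| fv i t, fv i.+1 u | fv i.+1 v]
  end.

(* [lin i t]: the variable [i] is consumed exactly once in [t], where [Unit] and
   the unused context of [Absurd] may consume anything. *)
Fixpoint lin S (i : nat) (t : term S) : bool :=
  match t with
  | Var j => i == j
  | Star _ | Promote _ => false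
  | Unit => true
  | Absurd t => lin i t || ~~ fv i t
  | Scal _ t | Inl t | Inr t => lin i t
  | Sum t u | WPair t u => lin i t && lin i u
  | LetOne t u | App t u | TPair t u =>
      lin i t && ~~ fv i u || ~~ fv i t && lin i u
  | Lam _ t => lin i.+1 t
  | LetTensor t _ _ u => lin i t && ~~ fv i.+2 u || ~~ fv i t && lin i.+2 u
  | LetFst t _ u | LetSnd t _ u | LetBang t _ u =>
      lin i t && ~~ fv i.+1 u || ~~ fv i t && lin i.+1 u
  | Case t _ u _ v =>
      [&& lin i t, ~~ fv i.+1 u & ~~ fv i.+1 v]
      || [&& ~~ fv i t, lin i.+1 u & lin i.+1 v]
  end.

Ltac destruct_bool :=
  repeat match goal with
  | H : is_true (_ && _) |- _ => case/andP: H => *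
  | H : is_true (_ || _) |- _ => case/orP: H => *
  | H : is_true (~~ (_ || _)) |- _ => move: H; rewrite negb_or => /andP [? ?]
  end.

Ltac split_bool :=
  repeat match goal with
  | |- _ || _ = _ => congr (_ || _)
  | |- _ && _ = _ => congr (_ && _)
  | |- ~~ _ = _ => congr (~~ _)
  end.

Section Substitution.
Variable S : Type.
Implicit Types (t u v w : term S) (r : nat -> nat) (s : nat -> term S).

Lemma up_substS s i : up_subst s i.+1 = rename succn (s i). Proof. by []. Qed.

Lemma eq_subst t s1 s2 :
  (forall i, fv i t -> s1 i = s2 i) -> subst s1 t = subst s2 t.
Proof.
elim: t s1 s2 => /=; intros; f_equal;
  repeat match goal with
  | IH : forall s1 s2, _ -> subst s1 ?t = subst s2 ?t |- subst _ ?t = _ =>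
      apply: IH => i fi
  | E : forall i, _ -> ?s1 i = ?s2 i |- ?s1 ?i = ?s2 ?i =>
      by apply: E; rewrite ?fi ?eqxx ?orbT
  | F : is_true (fv _ _) |- up_subst _ ?i = up_subst _ ?i =>
      case: i F => [|i] fi //; rewrite !up_substS; congr (rename _ _)
  end.
by rewrite H.
Qed.

Lemma up_ren_comp r1 r2 : up_ren r2 \o up_ren r1 = up_ren (r2 \o r1).
Proof. by apply: functional_extensionality => -[|i]. Qed.

Lemma rename_rename t r1 r2 :
  rename r2 (rename r1 t) = rename (r2 \o r1) t.
Proof.
elim: t r1 r2 => //=; intros; f_equal;
  by match goal with IH : forall r1 r2, rename r2 (rename r1 ?t) = _ |-
       rename _ (rename _ ?t) = _ => rewrite IH ?up_ren_comp end.
Qed.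

Lemma up_subst_ren r s : up_subst s \o up_ren r = up_subst (s \o r).
Proof. by apply: functional_extensionality => -[|i]. Qed.

Lemma subst_rename t r s : subst s (rename r t) = subst (s \o r) t.
Proof.
elim: t r s => //=; intros; f_equal;
  by match goal with IH : forall r s, subst s (rename r ?t) = _ |-
       subst _ (rename _ ?t) = _ => rewrite IH ?up_subst_ren end.
Qed.

Lemma up_ren_subst r s :
  rename (up_ren r) \o up_subst s = up_subst (rename r \o s).
Proof.
apply: functional_extensionality => -[|i] //=.
by rewrite /up_subst /= !rename_rename.
Qed.

Lemma rename_subst t r s : rename r (subst s t) = subst (rename r \o s) t.
Proof.
elim: t r s => //=; intros; f_equal;
  by match goal with IH : forall r s, rename r (subst s ?t) = _ |-
       rename _ (subst _ ?t) = _ => rewrite IH ?up_ren_subst end.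
Qed.

Lemma up_subst_comp s1 s2 :
  subst (up_subst s2) \o up_subst s1 = up_subst (subst s2 \o s1).
Proof.
apply: functional_extensionality => -[|i] //=.
by rewrite /up_subst /= subst_rename rename_subst.
Qed.

Lemma subst_subst t s1 s2 : subst s2 (subst s1 t) = subst (subst s2 \o s1) t.
Proof.
elim: t s1 s2 => //=; intros; f_equal;
  by match goal with IH : forall s1 s2, subst s2 (subst s1 ?t) = _ |-
       subst _ (subst _ ?t) = _ => rewrite IH ?up_subst_comp end.
Qed.

Lemma up_subst_Var : up_subst Var = Var :> (nat -> term S).
Proof. by apply: functional_extensionality => -[|i]. Qed.

Lemma subst_Var t : subst Var t = t.
Proof. by elim: t => //=; intros; rewrite ?up_subst_Var; f_equal. Qed.

Lemma subst1_up t u s : subst1 u (subst (up_subst s) t) = subst (scons u s) t.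
Proof.
rewrite /subst1 subst_subst; congr subst.
apply: functional_extensionality => -[|i] //=.
by rewrite subst_rename subst_Var.
Qed.

Lemma subst2_up t u v s :
  subst2 u v (subst (up_subst (up_subst s)) t) = subst (scons v (scons u s)) t.
Proof.
rewrite /subst2 subst_subst; congr subst.
apply: functional_extensionality => -[|[|i]] //=.
by rewrite !subst_rename subst_Var.
Qed.

Lemma subst_subst1 t u s :
  subst s (subst1 u t) = subst1 (subst s u) (subst (up_subst s) t).
Proof.
rewrite subst1_up /subst1 subst_subst; congr subst.
by apply: functional_extensionality => -[|i].
Qed.

Lemma subst_subst2 t u v s :
  subst s (subst2 u v t) =
  subst2 (subst s u) (subst s v) (subst (up_subst (up_subst s)) t).
Proof.
rewrite subst2_up /subst2 subst_subst; congr subst.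
by apply: functional_extensionality => -[|[|i]].
Qed.

(** The hypothesis makes [i] the only index that [r] sends to [k]. This is enough to transport [fv]
    and [lin] along a renaming, and it survives passing under a binder. *)
Lemma up_ren_eq r i k : (forall j, (k == r j) = (i == j)) ->
  forall j, (k.+1 == up_ren r j) = (i.+1 == j).
Proof. by move=> e [|j] //; rewrite /= !eqSS e. Qed.

Lemma fv_rename t r i k : (forall j, (k == r j) = (i == j)) ->
  fv k (rename r t) = fv i t.
Proof.
elim: t r i k => //=; intros; split_bool; try done;
  match goal with
  IH : forall r i k, _ -> fv k (rename r ?t) = _ |- fv _ (rename _ ?t) = _ =>
    by apply: IH; do ?[apply: up_ren_eq]
  end.
Qed.

Lemma lin_rename t r i k : (forall j, (k == r j) = (i == j)) ->
  lin k (rename r t) = lin i t.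
Proof.
elim: t r i k => //=; intros; split_bool; try done;
  match goal with
  | IH : forall r i k, _ -> lin k (rename r ?t) = _
      |- lin _ (rename _ ?t) = _ =>
    by apply: IH; do ?[apply: up_ren_eq]
  | |- fv _ _ = _ => by apply: fv_rename; do ?[apply: up_ren_eq]
  end.
Qed.

Lemma fv_rename_notin t r k : (forall j, k != r j) -> ~~ fv k (rename r t).
Proof.
have up r' (k' : nat) : (forall j, k' != r' j) ->
    forall j, k'.+1 != up_ren r' j by move=> e [|j] //=; rewrite eqSS.
elim: t r k => //=; intros; rewrite ?negb_or -?andbA;
  repeat (apply/andP; split); try done;
  match goal with
  IH : forall r k, _ -> is_true (~~ fv k (rename r ?t))
      |- context [rename _ ?t] =>
    by apply: IH; do ?[apply: (up)]
  end.
Qed.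

Lemma fv_succ t i : fv i.+1 (rename succn t) = fv i t.
Proof. exact: fv_rename. Qed.

Lemma lin_succ t i : lin i.+1 (rename succn t) = lin i t.
Proof. exact: lin_rename. Qed.

Lemma fv0_succ t : fv 0 (rename succn t) = false.
Proof. by apply/negbTE; exact: fv_rename_notin. Qed.

Lemma fv_subst t s i : (forall j, fv j t -> ~~ fv i (s j)) ->
  ~~ fv i (subst s t).
Proof.
elim: t s i => /=; intros; rewrite ?negb_or -?andbA; repeat (apply/andP; split);
  repeat match goal with
  | IH : forall s i, _ -> is_true (~~ fv i (subst s ?t))
      |- is_true (~~ fv _ (subst _ ?t)) =>
      apply: IH => j fj
  | E : forall j, _ -> is_true (~~ fv ?i (?s j))
      |- is_true (~~ fv ?i (?s ?j)) =>
      by apply: E; rewrite ?fj ?eqxx ?orbT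
  | F : is_true (fv _ _) |- is_true (~~ fv _ (up_subst _ ?j)) =>
      case: j F => [|j] fj //; rewrite up_substS ?fv_succ ?fv0_succ //
  end; by [].
Qed.

Ltac lin_subst_tac :=
  repeat match goal with
  | H : is_true (lin ?j ?t), IH : forall s i j, is_true (lin j ?t) -> _
      |- is_true (lin _ (subst _ ?t)) => apply: (IH _ _ _ H) => [|k fk kj]
  | |- is_true (~~ fv _ (subst _ ?t)) => apply: fv_subst => k fk
  | N : is_true (~~ fv ?j ?t), F : is_true (fv ?k ?t) |- _ =>
      have kj : k != j by [apply: contraNneq N => <-]; clear N
  | E : forall k, _ -> is_true (k != _) -> is_true (~~ fv ?i (?s k))
      |- is_true (~~ fv ?i (?s ?k)) =>
      apply: E => //;
      by match goal with F : is_true (fv _ _) |- _ => rewrite F ?orbT end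
  | F : is_true (fv _ _), N : is_true (_ != _)
      |- is_true (~~ fv _ (up_subst _ ?k)) =>
      case: k F N => [|k] fk kj //; rewrite up_substS ?fv_succ ?fv0_succ //
  | |- is_true (lin _ (up_subst _ _)) => rewrite up_substS lin_succ
  end; done.

(** All occurrences of [i] in the result come from [s j], so [i] inherits the single use of [j]. If
    [Absurd] merely discards [j], it discards [i] as well. *)
Lemma lin_subst t s i j : lin j t -> lin i (s j) ->
  (forall k, fv k t -> k != j -> ~~ fv i (s k)) -> lin i (subst s t).
Proof.
elim: t s i j => //=; intros;
  destruct_bool; rewrite ?negb_or -?andbA.
by rewrite -(eqP H).
all: try (apply/orP; left; repeat (apply/andP; split); lin_subst_tac).
all: try (apply/orP; right; repeat (apply/andP; split); lin_subst_tac).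
all: try (repeat (apply/andP; split); lin_subst_tac).
Qed.
End Substitution.

(** * Typing without context splitting *)

(* A single, total context: instead of splitting it, the rules for linear
   binders ask that the bound variable satisfy [lin]. *)
Inductive ltyped (S : Type) :
    (nat -> proposition) -> term S -> proposition -> Prop :=
| L_var G i : ltyped G (Var i) (G i)
| L_sum G t u A : ltyped G t A -> ltyped G u A -> ltyped G (Sum t u) A
| L_scal G a t A : ltyped G t A -> ltyped G (Scal a t) A
| L_star G a : ltyped G (Star a) One
| L_letone G t u A : ltyped G t One -> ltyped G u A -> ltyped G (LetOne t u) A
| L_lam G A t B : ltyped (scons A G) t B -> lin 0 t ->
    ltyped G (Lam A t) (Lolli A B)
| L_app G t u A B : ltyped G t (Lolli A B) -> ltyped G u A ->
    ltyped G (App t u) B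
| L_tpair G t u A B : ltyped G t A -> ltyped G u B ->
    ltyped G (TPair t u) (Tensor A B)
| L_lettensor G t A B u C : ltyped G t (Tensor A B) ->
    ltyped (scons B (scons A G)) u C -> lin 0 u -> lin 1 u ->
    ltyped G (LetTensor t A B u) C
| L_unit G : ltyped G Unit Top
| L_absurd G t C : ltyped G t Zero -> ltyped G (Absurd t) C
| L_wpair G t u A B : ltyped G t A -> ltyped G u B ->
    ltyped G (WPair t u) (With A B)
| L_letfst G t A B u C : ltyped G t (With A B) -> ltyped (scons A G) u C ->
    lin 0 u -> ltyped G (LetFst t A u) C
| L_letsnd G t A B u C : ltyped G t (With A B) -> ltyped (scons B G) u C ->
    lin 0 u -> ltyped G (LetSnd t B u) C
| L_inl G t A B : ltyped G t A -> ltyped G (Inl t) (Plus A B)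
| L_inr G t A B : ltyped G t B -> ltyped G (Inr t) (Plus A B)
| L_case G t A u B v C : ltyped G t (Plus A B) ->
    ltyped (scons A G) u C -> lin 0 u ->
    ltyped (scons B G) v C -> lin 0 v -> ltyped G (Case t A u B v) C
| L_promote G t A : ltyped G t A -> ltyped G (Promote t) (Bang A)
| L_letbang G t A u B : ltyped G t (Bang A) -> ltyped (scons A G) u B ->
    ltyped G (LetBang t A u) B.

Section LinearTyping.
Variable S : Type.
Implicit Types (t u v w : term S) (G D : nat -> proposition).

Lemma lin0_up_ren t r : lin 0 (rename (up_ren r) t) = lin 0 t.
Proof. by apply: lin_rename => -[|j]. Qed.

Lemma lin1_up_ren t r : lin 1 (rename (up_ren (up_ren r)) t) = lin 1 t.
Proof. by apply: lin_rename => -[|[|j]]. Qed.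

Lemma lin0_up_subst t s : lin 0 t -> lin 0 (subst (up_subst s) t).
Proof.
by move=> /lin_subst; apply=> // -[|k] // _ _; rewrite up_substS fv0_succ.
Qed.

Lemma lin1_up_subst t s : lin 1 t -> lin 1 (subst (up_subst (up_subst s)) t).
Proof.
move=> /lin_subst; apply=> // -[|[|k]] // _ _.
by rewrite !up_substS fv_succ fv0_succ.
Qed.

Lemma ltyped_rename G t A : ltyped G t A ->
  forall D r, (forall i, G i = D (r i)) -> ltyped D (rename r t) A.
Proof.
have up C G' D' r : (forall i, G' i = D' (r i)) ->
    forall i, scons C G' i = scons C D' (up_ren r i) by move=> e [|i] /=.
elim=> /=; intros; try (by rewrite H; constructor);
  econstructor; rewrite ?lin0_up_ren ?lin1_up_ren; eauto.
Qed.

(** No linearity is asked of [s], because [ltyped] constrains bound variables only, and [up_subst]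
    keeps these out of the images of the others. *)
Lemma ltyped_subst G t A : ltyped G t A ->
  forall D s, (forall i, ltyped D (s i) (G i)) -> ltyped D (subst s t) A.
Proof.
have up C G' D' s : (forall i, ltyped D' (s i) (G' i)) ->
    forall i, ltyped (scons C D') (up_subst s i : term S) (scons C G' i).
  move=> e [|i] /=; first exact: (L_var _ (scons C D') 0).
  exact: (ltyped_rename (e i)).
by elim=> /=; intros; try (by []); econstructor;
  eauto using lin0_up_subst, lin1_up_subst.
Qed.

Lemma ltyped_subst1 G A u t B : ltyped G u A -> ltyped (scons A G) t B ->
  ltyped G (subst1 u t) B.
Proof. by move=> hu /ltyped_subst; apply=> -[|i] //=; constructor. Qed.

Lemma ltyped_subst2 G A1 A2 u v t B : ltyped G u A1 -> ltyped G v A2 ->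
  ltyped (scons A2 (scons A1 G)) t B -> ltyped G (subst2 u v t) B.
Proof. by move=> hu hv /ltyped_subst; apply=> -[|[|i]] //=; constructor. Qed.

(** Both halves of a split stay disjoint from [Y], and every linear variable gets exactly one owner:
    the two facts used at each multiplicative rule. *)
Lemma disj_union_split (Y T G D : ctx) : disj_union T G D ->
  (forall i, lookup Y i = None \/ lookup T i = None) ->
  [/\ forall i, lookup Y i = None \/ lookup G i = None,
      forall i, lookup Y i = None \/ lookup D i = None,
      forall i B, lookup G i = Some B \/ lookup D i = Some B ->
        lookup T i = Some B,
      forall i, lookup T i <> None ->
        lookup Y i = None /\
        (lookup G i <> None /\ lookup D i = None \/
         lookup G i = None /\ lookup D i <> None) &
      forall i, lookup T i = None -> lookup G i = None /\ lookup D i = None].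
Proof.
move=> hT dT; split=> i; move: (hT i) (dT i);
  case: (lookup Y i) => [?|]; case: (lookup G i) => [?|];
  case: (lookup D i) => [?|]; case: (lookup T i) => [?|]; intuition congruence.
Qed.

(** The clauses on [lin] and [fv] need each other: at a split, a variable must be linear on the side
    that owns it and absent from the other. Disjointness of [Y] and [G] gives that absence, as the
    variable is then unknown to both contexts of the other side. Outside [Y] and [G] the total
    context is arbitrary. *)
Lemma typed_ltyped (Y G : ctx) t A : typed Y G t A ->
  (forall i, lookup Y i = None \/ lookup G i = None) ->
  [/\ forall D, (forall i B, lookup Y i = Some B \/ lookup G i = Some B ->
        D i = B) -> ltyped D t A,
      forall i, lookup G i <> None -> lin i t &
      forall i, lookup Y i = None -> lookup G i = None -> ~~ fv i t].
Proof.
have up (Y' G' : ctx) a b : (a = None \/ b = None) ->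
    (forall i, lookup Y' i = None \/ lookup G' i = None) ->
    forall i, lookup (a :: Y') i = None \/ lookup (b :: G') i = None.
  by move=> ab e [|i] /=.
have upD (Y' G' : ctx) D a b B : (a = Some B \/ b = Some B) ->
    (a = None \/ b = None) ->
    (forall i B, lookup Y' i = Some B \/ lookup G' i = Some B -> D i = B) ->
    forall i C, lookup (a :: Y') i = Some C \/ lookup (b :: G') i = Some C ->
    scons B D i = C.
  by move=> aB ab e [|i] C /=; [intuition congruence | exact: e].
elim=> {Y G t A}.
- move=> Y G i A [Gi GN] dis; split.
  + by move=> D eD; rewrite -(eD i A); [constructor | right].
  + by move=> j; case: (j =P i) => [-> /=|/eqP /GN ->] //; rewrite eqxx.
  + by move=> j _ Gj /=; apply/eqP => ji; move: Gj; rewrite ji Gi.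
- move=> Y G i A Yi GN dis; split.
  + by move=> D eD; rewrite -(eD i A); [constructor | left].
  + by move=> j; rewrite GN.
  + by move=> j Yj _ /=; apply/eqP => ji; move: Yj; rewrite ji Yi.
- move=> Y G t u A _ IHt _ IHu dis.
  have [tyt lt ft] := IHt dis; have [tyu lu fu] := IHu dis; split=> /=.
  + by move=> E eE; constructor; auto.
  + by move=> i Gi; rewrite lt ?lu.
  + by move=> i Yi Gi; rewrite negb_or ft ?fu.
- move=> Y G a t A _ IHt dis; have [tyt lt ft] := IHt dis; split=> //=.
  by move=> E eE; constructor; auto.
- move=> Y G a GN dis; split=> //=.
  by move=> *; constructor.
- move=> Y T G D t u A /disj_union_split hT _ IHt _ IHu.
  move=> /hT [dG dD sub own none].
  have [tyt lt ft] := IHt dG; have [tyu lu fu] := IHu dD; split=> /=.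
  + by move=> E eE; econstructor; [apply: tyt|apply: tyu]; intuition eauto.
  + move=> i /own [Yi [[Gi Di]|[Gi Di]]]; apply/orP; [left|right].
      by rewrite lt ?fu.
    by rewrite lu ?ft.
  + by move=> i Yi /none [Gi Di]; rewrite negb_or ft ?fu.
- move=> Y G A t B _ IHt dis; have [|tyt lt ft] := IHt _.
    by apply: (up); auto.
  split=> /=.
  + by move=> E eE; constructor; [apply: tyt; apply: (upD); auto | exact: lt].
  + by move=> i Gi; apply: lt.
  + by move=> i Yi Gi; apply: ft.
- move=> Y T G D t u A B /disj_union_split hT _ IHt _ IHu.
  move=> /hT [dG dD sub own none].
  have [tyt lt ft] := IHt dG; have [tyu lu fu] := IHu dD; split=> /=.
  + by move=> E eE; econstructor; [apply: tyt|apply: tyu]; intuition eauto.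
  + move=> i /own [Yi [[Gi Di]|[Gi Di]]]; apply/orP; [left|right].
      by rewrite lt ?fu.
    by rewrite lu ?ft.
  + by move=> i Yi /none [Gi Di]; rewrite negb_or ft ?fu.
- move=> Y T G D t u A B /disj_union_split hT _ IHt _ IHu.
  move=> /hT [dG dD sub own none].
  have [tyt lt ft] := IHt dG; have [tyu lu fu] := IHu dD; split=> /=.
  + by move=> E eE; econstructor; [apply: tyt|apply: tyu]; intuition eauto.
  + move=> i /own [Yi [[Gi Di]|[Gi Di]]]; apply/orP; [left|right].
      by rewrite lt ?fu.
    by rewrite lu ?ft.
  + by move=> i Yi /none [Gi Di]; rewrite negb_or ft ?fu.
- move=> Y T G D t A B u C /disj_union_split hT _ IHt _ IHu.
  move=> /hT [dG dD sub own none].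
  have [tyt lt ft] := IHt dG.
  have [|tyu lu fu] := IHu _; first by do 2?apply: (up); auto.
  split=> /=.
  + move=> E eE; econstructor; [apply: tyt|apply: tyu|exact: lu|exact: lu].
      by intuition eauto.
    by do 2!(apply: (upD); auto); intuition eauto.
  + move=> i /own [Yi [[Gi Di]|[Gi Di]]]; apply/orP; [left|right].
      by rewrite lt ?fu.
    by rewrite lu ?ft.
  + by move=> i Yi /none [Gi Di]; rewrite negb_or ft ?fu.
- by move=> Y G dis; split=> //= *; constructor.
- move=> Y T G D t C /disj_union_split hT _ IHt /hT [dG dD sub own none].
  have [tyt lt ft] := IHt dG; split=> /=.
  + by move=> E eE; constructor; apply: tyt; intuition eauto.
  + move=> i /own [Yi [[Gi Di]|[Gi Di]]]; apply/orP; [left|right].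
      by rewrite lt.
    by rewrite ft.
  + by move=> i Yi /none [Gi Di]; rewrite ft.
- move=> Y G t u A B _ IHt _ IHu dis.
  have [tyt lt ft] := IHt dis; have [tyu lu fu] := IHu dis; split=> /=.
  + by move=> E eE; constructor; auto.
  + by move=> i Gi; rewrite lt ?lu.
  + by move=> i Yi Gi; rewrite negb_or ft ?fu.
- move=> Y T G D t A B u C /disj_union_split hT _ IHt _ IHu.
  move=> /hT [dG dD sub own none].
  have [tyt lt ft] := IHt dG.
  have [|tyu lu fu] := IHu _; first by apply: (up); auto.
  split=> /=.
  + move=> E eE; econstructor; [apply: tyt|apply: tyu|exact: lu].
      by intuition eauto.
    by apply: (upD); auto; intuition eauto.
  + move=> i /own [Yi [[Gi Di]|[Gi Di]]]; apply/orP; [left|right].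
      by rewrite lt ?fu.
    by rewrite lu ?ft.
  + by move=> i Yi /none [Gi Di]; rewrite negb_or ft ?fu.
- move=> Y T G D t A B u C /disj_union_split hT _ IHt _ IHu.
  move=> /hT [dG dD sub own none].
  have [tyt lt ft] := IHt dG.
  have [|tyu lu fu] := IHu _; first by apply: (up); auto.
  split=> /=.
  + move=> E eE; econstructor; [apply: tyt|apply: tyu|exact: lu].
      by intuition eauto.
    by apply: (upD); auto; intuition eauto.
  + move=> i /own [Yi [[Gi Di]|[Gi Di]]]; apply/orP; [left|right].
      by rewrite lt ?fu.
    by rewrite lu ?ft.
  + by move=> i Yi /none [Gi Di]; rewrite negb_or ft ?fu.
- move=> Y G t A B _ IHt dis; have [tyt lt ft] := IHt dis; split=> //=.
  by move=> E eE; constructor; auto.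
- move=> Y G t A B _ IHt dis; have [tyt lt ft] := IHt dis; split=> //=.
  by move=> E eE; constructor; auto.
- move=> Y T G D t A u B v C /disj_union_split hT _ IHt _ IHu _ IHv.
  move=> /hT [dG dD sub own none]; have [tyt lt ft] := IHt dG.
  have [|tyu lu fu] := IHu _; first by apply: (up); auto.
  have [|tyv lv fv'] := IHv _; first by apply: (up); auto.
  split=> /=.
  + move=> E eE.
    econstructor; [apply: tyt|apply: tyu|exact: lu|apply: tyv|exact: lv].
      by intuition eauto.
      by apply: (upD); auto; intuition eauto.
    by apply: (upD); auto; intuition eauto.
  + move=> i /own [Yi [[Gi Di]|[Gi Di]]]; apply/orP; [left|right].
      by rewrite lt ?fu ?fv'.
    by rewrite lu ?lv ?ft.
  + by move=> i Yi /none [Gi Di]; rewrite !negb_or ft ?fu ?fv'.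
- move=> Y G t A GN _ IHt dis; have [tyt lt ft] := IHt dis; split=> //=.
  by move=> E eE; constructor; auto.
- move=> Y T G D t A u B /disj_union_split hT _ IHt _ IHu.
  move=> /hT [dG dD sub own none].
  have [tyt lt ft] := IHt dG.
  have [|tyu lu fu] := IHu _; first by apply: (up); auto.
  split=> /=.
  + move=> E eE; econstructor; [apply: tyt|apply: tyu].
      by intuition eauto.
    by apply: (upD); auto; intuition eauto.
  + move=> i /own [Yi [[Gi Di]|[Gi Di]]]; apply/orP; [left|right].
      by rewrite lt ?fu.
    by rewrite lu ?ft.
  + by move=> i Yi /none [Gi Di]; rewrite negb_or ft ?fu.
Qed.

End LinearTyping.

(** * Free and linear variables of a contracted body *)

Section LinearSubstitution.
Variable S : Type.
Implicit Types (t u v w : term S).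

Lemma fv_subst1 i u t : ~~ fv i u -> ~~ fv i.+1 t -> ~~ fv i (subst1 u t).
Proof.
move=> iu it; apply: fv_subst => -[|k] //= fk.
by apply: contraNneq it => ->.
Qed.

Lemma fv_subst2 i u v t : ~~ fv i u -> ~~ fv i v -> ~~ fv i.+2 t ->
  ~~ fv i (subst2 u v t).
Proof.
move=> iu iv it; apply: fv_subst => -[|[|k]] //= fk.
by apply: contraNneq it => ->.
Qed.

Lemma lin_subst1_body i u t : ~~ fv i u -> lin i.+1 t -> lin i (subst1 u t).
Proof.
move=> iu /lin_subst; apply=> /=; first exact: eqxx.
by case=> //= k _; rewrite eqSS eq_sym.
Qed.

Lemma lin_subst1_arg i u t : lin i u -> lin 0 t -> ~~ fv i.+1 t ->
  lin i (subst1 u t).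
Proof.
move=> iu /lin_subst l0 it; apply: l0 => //= -[|k] //= fk _.
by apply: contraNneq it => ->.
Qed.

Lemma lin_subst2_body i u v t : ~~ fv i u -> ~~ fv i v -> lin i.+2 t ->
  lin i (subst2 u v t).
Proof.
move=> iu iv /lin_subst; apply=> /=; first exact: eqxx.
by case=> [|[|k]] //= _; rewrite !eqSS eq_sym.
Qed.

Lemma lin_subst2_fst i u v t : lin i u -> ~~ fv i v -> lin 1 t ->
  ~~ fv i.+2 t -> lin i (subst2 u v t).
Proof.
move=> iu iv /lin_subst l1 it; apply: l1 => //= -[|[|k]] //= fk _.
by apply: contraNneq it => ->.
Qed.

Lemma lin_subst2_snd i u v t : ~~ fv i u -> lin i v -> lin 0 t ->
  ~~ fv i.+2 t -> lin i (subst2 u v t).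
Proof.
move=> iu iv /lin_subst l0 it; apply: l0 => //= -[|[|k]] //= fk _.
by apply: contraNneq it => ->.
Qed.
End LinearSubstitution.

(** * Subject reduction *)

Ltac invert_ltyped :=
  repeat match goal with
  | H : ltyped _ (?f _) _ |- _ => inversion H; subst; clear H
  end.

Section SubjectReduction.
Variable S : comPzSemiRingType.
Implicit Types (t u v w : term S) (G D : nat -> proposition).

Lemma head_red_fv t t' i : head_red t t' -> ~~ fv i t -> ~~ fv i t'.
Proof.
case=> /=; intros;
  destruct_bool;
  rewrite ?negb_or; repeat (apply/andP; split);
  rewrite ?fv_subst1 ?fv_subst2 //.
Qed.

Lemma head_red_ltyped t t' G A :
  head_red t t' -> ltyped G t A -> ltyped G t' A.
Proof.
case=> *; invert_ltyped; eauto using ltyped, ltyped_subst1, ltyped_subst2.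
by constructor; [exact: L_sum | apply/andP].
Qed.

(** Typing is essential: a redex that drops or copies its bound variable would drop or copy the
    resources of its argument, and [ltyped] supplies the [lin] of that variable. For
    [LetBang (Promote t) A u], a linear [i] is not free in [t], so copying [t] is harmless. *)
Lemma head_red_lin t t' G A i :
  head_red t t' -> ltyped G t A -> lin i t -> lin i t'.
Proof.
case=> /=.
(* The rules without substitution only rearrange subterms; they become Boolean tautologies in the
   atoms [fv] and [lin]. *)
all: try (by intros; repeat match goal with
  | H : is_true ?b |- _ => move: H end;
  repeat match goal with
  | |- context [fv ?a ?b] => case: (fv a b)
  | |- context [lin ?a ?b] => case: (lin a b)
  end).
all: intros; invert_ltyped;
  destruct_bool; auto using lin_subst1_body, lin_subst1_arg, lin_subst2_body,
   lin_subst2_fst, lin_subst2_snd.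
Qed.

Lemma red_fv t t' i : red t t' -> ~~ fv i t -> ~~ fv i t'.
Proof.
move=> r; elim: r i => {t t'} /=.
  by move=> *; eauto using head_red_fv.
all: intros;
  destruct_bool;
  rewrite ?negb_or; repeat (apply/andP; split); auto.
Qed.

Lemma red_lin t t' G A i : red t t' -> ltyped G t A -> lin i t -> lin i t'.
Proof.
move=> r; elim: r G A i => {t t'} /=.
  by move=> *; eauto using head_red_lin.
all: intros; invert_ltyped;
  destruct_bool.
all: try (apply/orP; left; repeat (apply/andP; split); by eauto using red_fv).
all: try (apply/orP; right; repeat (apply/andP; split); by eauto using red_fv).
all: try (repeat (apply/andP; split); by eauto using red_fv).
Qed.

Lemma red_ltyped t t' G A : red t t' -> ltyped G t A -> ltyped G t' A.
Proof.
move=> r; elim: r G A => {t t'} /=.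
  by move=> *; eauto using head_red_ltyped.
all: intros; invert_ltyped; eauto using ltyped, red_lin.
Qed.

End SubjectReduction.

(** * Evaluation *)

(** [vsum] compares annotations, since two abstractions can be added by reduction only if their
    annotations agree. *)
Definition proposition_eq_dec (A B : proposition) : {A = B} + {A <> B}.
Proof. by decide equality. Defined.

Section Evaluation.
Variable S : comPzSemiRingType.
Implicit Types (t u v w : term S).

Definition is_intro t : bool :=
  match t with
  | Star _ | Lam _ _ | TPair _ _ | Unit | WPair _ _ | Inl _ | Inr _
  | Promote _ => true
  | _ => false
  end.

Definition vsum v w : term S :=
  match v, w with
  | Star a, Star b => Star (a + b)
  | Lam A t, Lam B u =>
      if proposition_eq_dec A B then Lam A (Sum t u) else Sum v w
  | Unit, Unit => Unit
  | WPair t u, WPair t' u' => WPair (Sum t t') (Sum u u')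
  | _, _ => Sum v w
  end.

Definition vscal a v : term S :=
  match v with
  | Star b => Star (a * b)
  | Lam A t => Lam A (Scal a t)
  | Unit => Unit
  | WPair t u => WPair (Scal a t) (Scal a u)
  | _ => Scal a v
  end.

(** Result of commuting [LetTensor], [Case] or [LetBang] with all the [Sum] and [Scal] nodes of a
    value; [f] contracts the redex created at a leaf. *)
Fixpoint map_leaves (f : term S -> term S) t : term S :=
  match t with
  | Sum t u => Sum (map_leaves f t) (map_leaves f u)
  | Scal a t => Scal a (map_leaves f t)
  | _ => f t
  end.

Definition lettensor_leaf A B w t : term S :=
  if t is TPair u v then subst2 u v w else LetTensor t A B w.

Definition case_leaf A v B w t : term S :=
  match t with
  | Inl t => subst1 t v
  | Inr t => subst1 t w
  | _ => Case t A v B w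
  end.

Definition letbang_leaf A w t : term S :=
  if t is Promote u then subst1 u w else LetBang t A w.

(* A deterministic strategy for [red]: values of the types One, -o, Top and With
   are introduction forms, those of the other types are trees of [Sum] and
   [Scal] with introduction forms at the leaves. *)
Inductive eval : term S -> term S -> Prop :=
| E_intro t : is_intro t -> eval t t
| E_sum t u v w : eval t v -> eval u w -> eval (Sum t u) (vsum v w)
| E_scal a t v : eval t v -> eval (Scal a t) (vscal a v)
| E_letone t a u v : eval t (Star a) -> eval (Scal a u) v -> eval (LetOne t u) v
| E_app t A r u v :
    eval t (Lam A r) -> eval (subst1 u r) v -> eval (App t u) v
| E_lettensor t A B w v x : eval t v ->
    eval (map_leaves (lettensor_leaf A B w) v) x -> eval (LetTensor t A B w) x
| E_letfst t p q A w x :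
    eval t (WPair p q) -> eval (subst1 p w) x -> eval (LetFst t A w) x
| E_letsnd t p q A w x :
    eval t (WPair p q) -> eval (subst1 q w) x -> eval (LetSnd t A w) x
| E_case t A v B w y x : eval t y ->
    eval (map_leaves (case_leaf A v B w) y) x -> eval (Case t A v B w) x
| E_letbang t A w v x : eval t v ->
    eval (map_leaves (letbang_leaf A w) v) x -> eval (LetBang t A w) x.

Lemma eval_det t v w : eval t v -> eval t w -> v = w.
Proof.
move=> ev; elim: ev w => {t v} [[]//|||||||||];
  try (by move=> >; inversion 2; subst).
all: try (by move=> > _ IH1 _ IH2 w; inversion 1; subst => //;
  match goal with H : eval ?t _, IH : forall w, eval ?t w -> _ = w |- _ =>
    move: (IH _ H) => [] * end; subst; auto).
- by move=> > _ IH1 _ IH2 w; inversion 1; subst => //;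
    rewrite (IH1 _ H2) (IH2 _ H4).
- by move=> > _ IH w; inversion 1; subst => //; rewrite (IH _ H3).
Qed.

Notation "t ->> u" := (clos_refl_trans _ (@red S) t u) (at level 70).

Lemma reds_trans t u v : t ->> u -> u ->> v -> t ->> v.
Proof. exact: rt_trans. Qed.

Lemma red_reds t u v : red t u -> u ->> v -> t ->> v.
Proof. by move=> tu; apply: reds_trans; apply: rt_step. Qed.

Lemma reds_ctx (f : term S -> term S) t u :
  (forall t u, red t u -> red (f t) (f u)) -> t ->> u -> f t ->> f u.
Proof.
move=> hf; elim=> {t u} [t u tu|t|t u v _ tu _ uv].
- by apply: rt_step; apply: hf.
- exact: rt_refl.
- exact: reds_trans tu uv.
Qed.

Lemma head_reds t u v : head_red t u -> u ->> v -> t ->> v.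
Proof. by move=> tu; apply: red_reds; constructor. Qed.

Lemma vsum_reds v w : Sum v w ->> vsum v w.
Proof.
have head t u : head_red t u -> t ->> u.
  by move=> tu; apply: rt_step; constructor.
case: v => * /=; try exact: rt_refl;
  case: w => * /=; try exact: rt_refl; try (by apply: head; constructor).
case: proposition_eq_dec => [eq_A|_] /=; last exact: rt_refl.
by subst; apply: head; constructor.
Qed.

Lemma vscal_reds a v : Scal a v ->> vscal a v.
Proof.
have head t u : head_red t u -> t ->> u.
  by move=> tu; apply: rt_step; constructor.
case: v => * /=; try exact: rt_refl; try (by apply: head; constructor).
Qed.

(** [E] stands for any of the three eliminations that commute with [Sum] and [Scal]. *)
Lemma map_leaves_reds (E f : term S -> term S) v :
  (forall t u, red t u -> red (E t) (E u)) ->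
  (forall t u, red (E (Sum t u)) (Sum (E t) (E u))) ->
  (forall a t, red (E (Scal a t)) (Scal a (E t))) ->
  (forall t, E t ->> f t) -> E v ->> map_leaves f v.
Proof.
move=> ctxE sumE scalE leafE; elim: v => //=.
  move=> t IHt u IHu; apply: red_reds (sumE _ _) _.
  apply: (@reds_trans _ (Sum (map_leaves f t) (E u))).
    by apply: (reds_ctx (f := fun x => Sum x (E u))) IHt => *; constructor.
  by apply: (reds_ctx (f := fun x => Sum _ x)) IHu => *; constructor.
move=> a t IHt; apply: red_reds (scalE _ _) _.
by apply: (reds_ctx (f := fun x => Scal a x)) IHt => *; constructor.
Qed.

Lemma eval_reds t v : eval t v -> t ->> v.
Proof.
elim=> {t v}.
- move=> *; exact: rt_refl.
- move=> t u v w _ tv _ uw.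
  apply: (@reds_trans _ (Sum v u)).
    by apply: (reds_ctx (f := fun x => Sum x u)) tv => *; constructor.
  apply: (@reds_trans _ (Sum v w)).
    by apply: (reds_ctx (f := fun x => Sum v x)) uw => *; constructor.
  exact: vsum_reds.
- move=> a t v _ tv; apply: (@reds_trans _ (Scal a v)).
    by apply: (reds_ctx (f := fun x => Scal a x)) tv => *; constructor.
  exact: vscal_reds.
- move=> t a u v _ tv _ uv; apply: (@reds_trans _ (LetOne (Star a) u)).
    by apply: (reds_ctx (f := fun x => LetOne x u)) tv => *; constructor.
  by apply: head_reds uv; constructor.
- move=> t A r u v _ tv _ uv; apply: (@reds_trans _ (App (Lam A r) u)).
    by apply: (reds_ctx (f := fun x => App x u)) tv => *; constructor.
  by apply: head_reds uv; constructor.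
- move=> t A B w v x _ tv _ wx; apply: (@reds_trans _ (LetTensor v A B w)).
    by apply: (reds_ctx (f := fun x => LetTensor x A B w)) tv => *; constructor.
  apply: reds_trans wx.
  apply: (@map_leaves_reds (fun x => LetTensor x A B w)) =>
    [y1 y2|y1 y2|a y1|z]; [exact: R_lettensor1|apply: R_head; constructor
    |apply: R_head; constructor|].
  case: z => * /=; try exact: rt_refl;
    by apply: rt_step; apply R_head; constructor.
- move=> t p q A w x _ tv _ wx; apply: (@reds_trans _ (LetFst (WPair p q) A w)).
    by apply: (reds_ctx (f := fun x => LetFst x A w)) tv => *; constructor.
  by apply: head_reds wx; constructor.
- move=> t p q A w x _ tv _ wx; apply: (@reds_trans _ (LetSnd (WPair p q) A w)).
    by apply: (reds_ctx (f := fun x => LetSnd x A w)) tv => *; constructor.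
  by apply: head_reds wx; constructor.
- move=> t A v B w y x _ ty _ wx; apply: (@reds_trans _ (Case y A v B w)).
    by apply: (reds_ctx (f := fun x => Case x A v B w)) ty => *; constructor.
  apply: reds_trans wx.
  apply: (@map_leaves_reds (fun x => Case x A v B w)) =>
    [y1 y2|y1 y2|a y1|z]; [exact: R_case1|apply: R_head; constructor
    |apply: R_head; constructor|].
  case: z => * /=; try exact: rt_refl;
    by apply: rt_step; apply R_head; constructor.
- move=> t A w v x _ tv _ wx; apply: (@reds_trans _ (LetBang v A w)).
    by apply: (reds_ctx (f := fun x => LetBang x A w)) tv => *; constructor.
  apply: reds_trans wx.
  apply: (@map_leaves_reds (fun x => LetBang x A w)) =>
    [y1 y2|y1 y2|a y1|z]; [exact: R_letbang1|apply: R_head; constructor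
    |apply: R_head; constructor|].
  case: z => * /=; try exact: rt_refl;
    by apply: rt_step; apply R_head; constructor.
Qed.

(** Choice makes evaluation a total function, so that an observation composed with it is a
    functional on all terms. *)
Definition evl t : term S := epsilon (inhabits Unit) (eval t).

Lemma evlE t v : eval t v -> evl t = v.
Proof.
move=> tv; have: eval t (evl t) by apply: epsilon_spec; exists v.
by move/eval_det; apply.
Qed.

End Evaluation.

(** * Interpretation of propositions *)

Section Candidates.
Variable S : comPzSemiRingType.
Implicit Types (t u v w : term S).

(* [dom] is the set of values, [tst] the set of linear observations. *)
Record cand := Cand {
  dom : term S -> Prop;
  tst : (term S -> S) -> Prop }.
Implicit Types c d e : cand.

Definition halts c t : Prop := exists2 v, eval t v & dom c v.

(** A partial equivalence relation, reflexive exactly on the halting terms: an equivalence also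
    carries the termination of both sides. *)
Definition eqv c t u : Prop :=
  [/\ halts c t, halts c u & forall k, tst c k -> k (evl t) = k (evl u)].

Definition comb a b t u : term S := Sum (Scal a t) (Scal b u).

Definition respectful c (phi : term S -> S) : Prop :=
  forall t u, eqv c t u -> phi t = phi u.

Definition linear_on c (phi : term S -> S) : Prop :=
  respectful c phi /\
  forall a b t u, halts c t -> halts c u ->
    phi (comb a b t u) = a * phi t + b * phi u.

Definition linear_map c d (f : term S -> term S) : Prop :=
  (forall t u, eqv c t u -> eqv d (f t) (f u)) /\
  forall a b t u, halts c t -> halts c u ->
    eqv d (f (comb a b t u)) (comb a b (f t) (f u)).

Definition bilinear_on c d (beta : term S -> term S -> S) : Prop :=
  (forall t, halts c t -> linear_on d (beta t)) /\
  (forall u, halts d u -> linear_on c (beta^~ u)).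

Fixpoint leaves (L : term S -> Prop) t : Prop :=
  match t with
  | Sum t u => leaves L t /\ leaves L u
  | Scal _ t => leaves L t
  | _ => L t
  end.

Fixpoint fold_leaves (g : term S -> S) t : S :=
  match t with
  | Sum t u => fold_leaves g t + fold_leaves g u
  | Scal a t => a * fold_leaves g t
  | _ => g t
  end.

(** Multiplication by every scalar [s] is an observation, because [LetOne] with body [u] pulls [h]
    back to multiplication by [h (evl u)]. *)
Definition one_cand : cand :=
  Cand (fun v => exists a, v = Star a)
       (fun k => exists s, k = fun v => if v is Star a then a * s else 0).

Definition lolli_cand A c d : cand :=
  Cand (fun v => exists2 r, v = Lam A r & linear_map c d (fun u => subst1 u r))
       (fun k => exists u h, [/\ halts c u, tst d h &
          k = fun v => if v is Lam _ r then h (evl (subst1 u r)) else 0]).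

(** The components are seen through arbitrary linear functionals, not only through [tst]: a
    projection with body [w] pulls [h] back to the functional [p] maps to [h (evl (subst1 p w))], of
    which linearity is all that is known. *)
Definition with_cand c d : cand :=
  Cand (fun v => exists p q, [/\ v = WPair p q, halts c p & halts d q])
       (fun k => exists phi psi, [/\ linear_on c phi, linear_on d psi &
          k = fun v => if v is WPair p q then phi p + psi q else 0]).

(** Formal combinations of leaves, observed through linear extensions. The relations among leaves
    are left to [T]; they yield a tensor product, a direct sum or a free module. *)
Definition leaf_cand (L : term S -> Prop) (T : (term S -> S) -> Prop) : cand :=
  Cand (leaves L) (fun k => exists2 g, T g & k = fold_leaves g).

Definition tensor_leaf c d v : Prop :=
  exists p q, [/\ v = TPair p q, halts c p & halts d q].
Definition plus_leaf c d v : Prop :=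
  (exists2 p, v = Inl p & halts c p) \/ (exists2 q, v = Inr q & halts d q).
Definition bang_leaf c v : Prop := exists2 p, v = Promote p & halts c p.

Definition tensor_cand c d : cand :=
  leaf_cand (tensor_leaf c d)
    (fun g => exists2 beta, bilinear_on c d beta &
       g = fun v => if v is TPair p q then beta p q else 0).

Definition plus_cand c d : cand :=
  leaf_cand (plus_leaf c d)
    (fun g => exists phi psi, [/\ linear_on c phi, linear_on d psi &
       g = fun v => match v with Inl p => phi p | Inr q => psi q | _ => 0 end]).

Definition bang_cand c : cand :=
  leaf_cand (bang_leaf c)
    (fun g => exists2 phi, respectful c phi &
       g = fun v => if v is Promote p then phi p else 0).

Fixpoint interp (A : proposition) : cand :=
  match A with
  | One => one_cand
  | Lolli A B => lolli_cand A (interp A) (interp B)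
  | Tensor A B => tensor_cand (interp A) (interp B)
  | Top => Cand (eq Unit) (fun _ => False)
  | Zero => Cand (fun _ => False) (fun _ => True)
  | With A B => with_cand (interp A) (interp B)
  | Plus A B => plus_cand (interp A) (interp B)
  | Bang A => bang_cand (interp A)
  end.

(** The laws of a module are not listed: observations take values in [S], so these laws hold up to
    [eqv]. *)
Definition is_module c : Prop :=
  (forall v w, dom c v -> dom c w -> dom c (vsum v w) /\
     forall k, tst c k -> k (vsum v w) = k v + k w) /\
  (forall a v, dom c v -> dom c (vscal a v) /\
     forall k, tst c k -> k (vscal a v) = a * k v).

Lemma eqv_refl c t : halts c t -> eqv c t t. Proof. by []. Qed.
Lemma eqv_sym c t u : eqv c t u -> eqv c u t.
Proof. by move=> [? ? e]; split=> // k /e. Qed.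
Lemma eqv_trans c t u v : eqv c t u -> eqv c u v -> eqv c t v.
Proof. by move=> [? ? e] [? ? e']; split=> // k hk; rewrite e ?e'. Qed.
Lemma eqv_l c t u : eqv c t u -> halts c t. Proof. by case. Qed.
Lemma eqv_r c t u : eqv c t u -> halts c u. Proof. by case. Qed.

Lemma evl_intro t : is_intro t -> evl t = t.
Proof. by move=> it; apply: evlE; constructor. Qed.

Lemma halts_dom c t : halts c t -> eval t (evl t) /\ dom c (evl t).
Proof. by case=> v tv dv; rewrite (evlE tv). Qed.

(** Closure under head expansion, the form in which most evaluation rules enter the semantics. *)
Lemma halts_expand c t u :
  (forall v, eval u v -> eval t v) -> halts c u -> eqv c t u.
Proof.
move=> tu [v uv dv]; split; try by exists v => //; apply: tu.
by move=> k _; rewrite (evlE uv) (evlE (tu _ uv)).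
Qed.

(** * Linear combinations of halting terms *)

Section Module.
Variables (c : cand) (cM : is_module c).

Lemma eval_sum_halts t u : halts c t -> halts c u ->
  eval (Sum t u) (vsum (evl t) (evl u)).
Proof. by move=> /halts_dom[? _] /halts_dom[? _]; constructor. Qed.

Lemma halts_sum t u : halts c t -> halts c u -> halts c (Sum t u).
Proof.
move=> ht hu; exists (vsum (evl t) (evl u)); first exact: eval_sum_halts.
have [[_ dt] [_ du]] := (halts_dom ht, halts_dom hu).
by case: (cM.1 _ _ dt du).
Qed.

Lemma halts_scal a t : halts c t -> halts c (Scal a t).
Proof.
move=> /halts_dom[et dt]; exists (vscal a (evl t)); first by constructor.
by case: (cM.2 a _ dt).
Qed.

Lemma halts_comb a b t u : halts c t -> halts c u -> halts c (comb a b t u).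
Proof. by move=> ht hu; apply: halts_sum; apply: halts_scal. Qed.

Lemma tst_sum k t u : tst c k -> halts c t -> halts c u ->
  k (evl (Sum t u)) = k (evl t) + k (evl u).
Proof.
move=> hk ht hu; rewrite (evlE (eval_sum_halts ht hu)).
have [[_ dt] [_ du]] := (halts_dom ht, halts_dom hu).
by case: (cM.1 _ _ dt du) => _; apply.
Qed.

Lemma tst_scal k a t : tst c k -> halts c t ->
  k (evl (Scal a t)) = a * k (evl t).
Proof.
move=> hk /halts_dom[et dt]; rewrite (evlE (E_scal a et)).
by case: (cM.2 a _ dt) => _; apply.
Qed.

Lemma tst_comb k a b t u : tst c k -> halts c t -> halts c u ->
  k (evl (comb a b t u)) = a * k (evl t) + b * k (evl u).
Proof.
by move=> hk ht hu; rewrite tst_sum ?tst_scal //; apply: halts_scal.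
Qed.

Lemma eqv_sum t u t' u' : eqv c t t' -> eqv c u u' ->
  eqv c (Sum t u) (Sum t' u').
Proof.
move=> [ht ht' et] [hu hu' eu]; split; try exact: halts_sum.
by move=> k hk; rewrite !tst_sum // et ?eu.
Qed.

Lemma eqv_scal a t t' : eqv c t t' -> eqv c (Scal a t) (Scal a t').
Proof.
move=> [ht ht' et]; split; try exact: halts_scal.
by move=> k hk; rewrite !tst_scal // et.
Qed.

Lemma eqv_comb a b t u t' u' : eqv c t t' -> eqv c u u' ->
  eqv c (comb a b t u) (comb a b t' u').
Proof. by move=> et eu; apply: eqv_sum; apply: eqv_scal. Qed.

Lemma tst_linear k : tst c k -> linear_on c (k \o @evl S).
Proof.
by move=> hk; split=> [t u [_ _]|a b t u ht hu] /=; [apply | exact: tst_comb].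
Qed.

(** Linearity is phrased with [comb] alone; the coefficients [1, 1] recover sums and [a, 0] recover
    scalings. In the second case [t] itself is the summand scaled by [0], as there is no zero term
    to put there. *)
Lemma eqv_sum_comb11 t u : halts c t -> halts c u ->
  eqv c (Sum t u) (comb 1 1 t u).
Proof.
move=> ht hu; split; [exact: halts_sum|exact: halts_comb|move=> k hk].
by rewrite tst_comb // !mul1r tst_sum.
Qed.

Lemma eqv_scal_comb0 a t : halts c t -> eqv c (Scal a t) (comb a 0 t t).
Proof.
move=> ht; split; [exact: halts_scal|exact: halts_comb|move=> k hk].
by rewrite tst_comb // mul0r addr0 tst_scal.
Qed.

Lemma linear_on_sum phi t u : linear_on c phi -> halts c t -> halts c u ->
  phi (Sum t u) = phi t + phi u.
Proof.
move=> [resp lin] ht hu; rewrite -[phi t]mul1r -[phi u]mul1r -lin //.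
exact/resp/eqv_sum_comb11.
Qed.

Lemma linear_on_scal phi a t : linear_on c phi -> halts c t ->
  phi (Scal a t) = a * phi t.
Proof.
move=> [resp lin] ht; rewrite -[RHS]addr0 -(mul0r (phi t)) -lin //.
exact/resp/eqv_scal_comb0.
Qed.

End Module.

Lemma linear_on0 c : linear_on c (fun _ => 0).
Proof. by split=> // a b t u _ _; rewrite !mulr0 addr0. Qed.

(** * Module structure of the connectives *)

Lemma one_module : is_module one_cand.
Proof.
split=> [_ _ [a ->] [b ->]|a _ [b ->]] /=; split=> [|k [s ->]].
- by exists (a + b).
- exact: mulrDl.
- by exists (a * b).
- by rewrite mulrA.
Qed.

Lemma linear_map_sum c d f g : is_module d ->
  linear_map c d f -> linear_map c d g ->
  linear_map c d (fun u => Sum (f u) (g u)).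
Proof.
move=> dM [f1 f2] [g1 g2]; split=> [t u tu|a b t u ht hu].
  by apply: (eqv_sum dM); [apply: f1 | apply: g1].
have [hft hgt] := (eqv_l (f1 _ _ (eqv_refl ht)), eqv_l (g1 _ _ (eqv_refl ht))).
have [hfu hgu] := (eqv_l (f1 _ _ (eqv_refl hu)), eqv_l (g1 _ _ (eqv_refl hu))).
have [[hfc _ ef] [hgc _ eg]] := (f2 a b t u ht hu, g2 a b t u ht hu).
have hSt := halts_sum dM hft hgt; have hSu := halts_sum dM hfu hgu.
split; [exact: halts_sum | exact: halts_comb | move=> k hk].
rewrite (tst_sum dM hk hfc hgc) ef // eg // !(tst_comb dM) // !(tst_sum dM) //.
by rewrite addrACA !mulrDr.
Qed.

(** Commutativity of multiplication enters here: the scalar [x] has to be exchanged with [a] and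
    [b]. *)
Lemma linear_map_scal c d f x : is_module d ->
  linear_map c d f -> linear_map c d (fun u => Scal x (f u)).
Proof.
move=> dM [f1 f2]; split=> [t u tu|a b t u ht hu].
  by apply: (eqv_scal dM); apply: f1.
have hft := eqv_l (f1 _ _ (eqv_refl ht)).
have hfu := eqv_l (f1 _ _ (eqv_refl hu)).
have [hfc _ ef] := f2 a b t u ht hu.
have hSt := halts_scal dM x hft; have hSu := halts_scal dM x hfu.
split; [exact: halts_scal | exact: halts_comb | move=> k hk].
rewrite (tst_scal dM x hk hfc) ef // !(tst_comb dM) // !(tst_scal dM) //.
by rewrite mulrDr mulrCA [x * (b * _)]mulrCA.
Qed.

Lemma linear_map_halts c d f u : linear_map c d f -> halts c u -> halts d (f u).
Proof. by move=> [f1 _] /eqv_refl /f1 /eqv_l. Qed.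

Lemma lolli_module A c d : is_module d -> is_module (lolli_cand A c d).
Proof.
move=> dM; split=> [_ _ [r -> lr] [r' -> lr']|a _ [r -> lr]] /=.
  case: proposition_eq_dec => //= _; split=> [|_ [u [h [hu hh ->]]]].
    by exists (Sum r r') => //; exact: (linear_map_sum dM lr lr').
  have [hr hr'] := (linear_map_halts lr hu, linear_map_halts lr' hu).
  exact: (tst_sum dM hh hr hr').
split=> [|_ [u [h [hu hh ->]]]].
  by exists (Scal a r) => //; exact: (linear_map_scal a dM lr).
exact: (tst_scal dM a hh (linear_map_halts lr hu)).
Qed.

Lemma with_module c d : is_module c -> is_module d -> is_module (with_cand c d).
Proof.
move=> cM dM.
split=> [_ _ [p [q [-> hp hq]]] [p' [q' [-> hp' hq']]]
        |a _ [p [q [-> hp hq]]]] /=.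
  split=> [|_ [phi [psi [lphi lpsi ->]]]].
    by do 2 eexists; split; first reflexivity; apply: halts_sum.
  by rewrite (linear_on_sum cM) // (linear_on_sum dM) // addrACA.
split=> [|_ [phi [psi [lphi lpsi ->]]]].
  by do 2 eexists; split; first reflexivity; apply: halts_scal.
by rewrite (linear_on_scal cM) // (linear_on_scal dM) // mulrDr.
Qed.

Definition is_leaf t : bool :=
  match t with TPair _ _ | Inl _ | Inr _ | Promote _ => true | _ => false end.

(** Sums and multiples of these introductions are never contracted, so [vsum] and [vscal] just grow
    the tree, on which [fold_leaves] is linear by definition. *)
Lemma leaf_module (L : term S -> Prop) T :
  (forall v, L v -> is_leaf v) -> is_module (leaf_cand L T).
Proof.
move=> hL; split=> [v w|a v] dv.
  move=> dw; have -> : vsum v w = Sum v w.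
    by case: v dv => //= > /hL.
  by split=> // _ [g _ ->].
have -> : vscal a v = Scal a v by case: v dv => //= > /hL.
by split=> // _ [g _ ->].
Qed.

Lemma interp_module A : is_module (interp A).
Proof.
elim: A => /=.
- exact: one_module.
- by move=> A _ B; exact: lolli_module.
- by move=> A _ B _; apply: leaf_module => _ [p [q [->]]].
- by split=> [_ _ <- <-|a _ <-].
- by [].
- by move=> A hA B; exact: with_module.
- by move=> A _ B _; apply: leaf_module => _ [] [p ->].
- by move=> A _; apply: leaf_module => _ [p ->].
Qed.

(** * Eliminations and their adjoints *)

(* [E] is an elimination form with principal argument in [c]: it acts on the
   values of [c] through the adjoint map [F] on observations. *)
Definition elim_spec c d (E : term S -> term S)
    (F : (term S -> S) -> term S -> S) : Prop :=
  (forall t, halts c t -> halts d (E t)) /\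
  forall h, tst d h -> tst c (F h) /\
    forall t, halts c t -> h (evl (E t)) = F h (evl t).

Lemma elim_eqv c d E E' F F' t t' : elim_spec c d E F -> elim_spec c d E' F' ->
  (forall h v, tst d h -> dom c v -> F h v = F' h v) ->
  eqv c t t' -> eqv d (E t) (E' t').
Proof.
move=> [hE eE] [hE' eE'] FF' [ht ht' tt']; split; [exact: hE|exact: hE'|].
move=> h hh; have [tF ->] := eE h hh; last by [].
have [_ ->] := eE' h hh; last by [].
by rewrite tt' // FF' //; case: (halts_dom ht').
Qed.

(** Linearity in the principal argument: [F h] is again an observation, and observations are
    linear. *)
Lemma elim_comb c d E F t a b t1 t2 : is_module c -> is_module d ->
  elim_spec c d E F -> halts c t1 -> halts c t2 ->
  eqv c t (comb a b t1 t2) -> eqv d (E t) (comb a b (E t1) (E t2)).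
Proof.
move=> cM dM [hE eE] h1 h2 [ht _ et]; split; [exact: hE| |move=> h hh].
  by apply: halts_comb => //; apply: hE.
have [tF FE] := eE h hh.
by rewrite (tst_comb dM) ?FE ?et ?(tst_comb cM) //; apply: hE.
Qed.

(** This and the next lemma justify the rules commuting an elimination with [Sum] and [Scal]. *)
Lemma elim_sum c d E F t u : is_module c -> is_module d ->
  elim_spec c d E F -> halts c t -> halts c u ->
  eqv d (E (Sum t u)) (Sum (E t) (E u)).
Proof.
move=> cM dM [hE eE] ht hu; split; [exact/hE/halts_sum| |move=> h hh].
  by apply: halts_sum => //; apply: hE.
have [tF FE] := eE h hh; have hs := halts_sum cM ht hu.
by rewrite (tst_sum dM) ?FE ?(tst_sum cM) //; apply: hE.
Qed.

Lemma elim_scal c d E F a t : is_module c -> is_module d ->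
  elim_spec c d E F -> halts c t -> eqv d (E (Scal a t)) (Scal a (E t)).
Proof.
move=> cM dM [hE eE] ht; split; [exact/hE/halts_scal| |move=> h hh].
  by apply: halts_scal => //; apply: hE.
have [tF FE] := eE h hh; have hs := halts_scal cM a ht.
by rewrite (tst_scal dM) ?FE ?(tst_scal cM) //; apply: hE.
Qed.

(** Linearity in the side argument: the principal term is fixed, and the adjoints are compared on
    its value. *)
Lemma elim_comb_body c d E E1 E2 F F1 F2 t a b : is_module d ->
  elim_spec c d E F -> elim_spec c d E1 F1 -> elim_spec c d E2 F2 ->
  (forall h v, tst d h -> dom c v -> F h v = a * F1 h v + b * F2 h v) ->
  halts c t -> eqv d (E t) (comb a b (E1 t) (E2 t)).
Proof.
move=> dM [hE eE] [hE1 eE1] [hE2 eE2] FF ht.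
split; [exact: hE|by apply: halts_comb; auto|move=> h hh].
have [h1 h2] := (hE1 t ht, hE2 t ht); rewrite (tst_comb dM) //.
have [_ ->] := eE h hh; last by [].
have [_ ->] := eE1 h hh; last by [].
have [_ ->] := eE2 h hh; last by [].
by rewrite FF //; case: (halts_dom ht).
Qed.

Definition letone_adj u (h : term S -> S) v : S :=
  if v is Star a then h (evl (Scal a u)) else 0.
Definition app_adj u (h : term S -> S) v : S :=
  if v is Lam _ r then h (evl (subst1 u r)) else 0.
Definition lettensor_adj w (h : term S -> S) : term S -> S :=
  fold_leaves (fun v => if v is TPair p q then h (evl (subst2 p q w)) else 0).
(** The summand [0] is the zero functional on the other component, kept so that the pullback has
    literally the shape of an observation of [with_cand]. *)
Definition letfst_adj w (h : term S -> S) v : S :=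
  if v is WPair p q then h (evl (subst1 p w)) + 0 else 0.
Definition letsnd_adj w (h : term S -> S) v : S :=
  if v is WPair p q then 0 + h (evl (subst1 q w)) else 0.
Definition case_adj w1 w2 (h : term S -> S) : term S -> S :=
  fold_leaves (fun v => match v with
    | Inl p => h (evl (subst1 p w1)) | Inr q => h (evl (subst1 q w2))
    | _ => 0 end).
Definition letbang_adj w (h : term S -> S) : term S -> S :=
  fold_leaves (fun v => if v is Promote p then h (evl (subst1 p w)) else 0).

(** Source of the functionals on components in the adjoints of [LetFst], [LetSnd], [LetTensor] and
    [Case]: an observation pulled back along a linear body. *)
Lemma linear_map_tst c d f h : is_module d -> linear_map c d f -> tst d h ->
  linear_on c (fun u => h (evl (f u))).
Proof.
move=> dM lf hh; have lh := linear_map_halts lf; case: lf => f1 f2; split.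
  by move=> t u /f1 [_ _]; apply.
move=> a b t u ht hu; case: (f2 a b t u ht hu) => _ _ -> //.
by rewrite (tst_comb dM) //; apply: lh.
Qed.

Lemma letone_spec d u : is_module d -> halts d u ->
  elim_spec one_cand d (fun t => LetOne t u) (letone_adj u).
Proof.
move=> dM hu.
have ev t : halts one_cand t -> exists2 a, evl t = Star a &
    eqv d (LetOne t u) (Scal a u).
  move=> /halts_dom [et [a ea]]; exists a => //; rewrite ea in et.
  by apply: halts_expand (halts_scal dM a hu) => v; exact: E_letone et.
split=> [t /ev[a _ /eqv_l]//|h hh]; split.
  exists (h (evl u)); apply: functional_extensionality => -[] //= a.
  exact: (tst_scal dM).
by move=> t /ev[a -> [_ _ ->]].
Qed.

Lemma app_spec A c d u : halts c u ->
  elim_spec (lolli_cand A c d) d (fun t => App t u) (app_adj u).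
Proof.
move=> hu.
have ev t : halts (lolli_cand A c d) t -> exists2 r, evl t = Lam A r &
    eqv d (App t u) (subst1 u r).
  move=> /halts_dom [et [r er lr]]; exists r => //; rewrite er in et.
  by apply: halts_expand (linear_map_halts lr hu) => v; exact: E_app et.
split=> [t /ev[r _ /eqv_l]//|h hh]; split; first by exists u, h.
by move=> t /ev[r -> [_ _ ->]].
Qed.

Lemma letfst_spec A c d e w : is_module e ->
  linear_map c e (fun p => subst1 p w) ->
  elim_spec (with_cand c d) e (fun t => LetFst t A w) (letfst_adj w).
Proof.
move=> eM lw.
have ev t : halts (with_cand c d) t -> exists p q, evl t = WPair p q /\
    eqv e (LetFst t A w) (subst1 p w).
  move=> /halts_dom [et [p [q [er hp hq]]]]; exists p, q; split=> //.
  rewrite er in et.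
  by apply: halts_expand (linear_map_halts lw hp) => v; exact: E_letfst et.
split=> [t /ev[p [q [_ /eqv_l]]]//|h hh]; split.
  exists (fun p => h (evl (subst1 p w))), (fun _ => 0); split=> //.
    exact: (linear_map_tst eM lw).
  exact: linear_on0.
by move=> t /ev[p [q [-> [_ _ ->]]]] //=; rewrite addr0.
Qed.

Lemma letsnd_spec A c d e w : is_module e ->
  linear_map d e (fun p => subst1 p w) ->
  elim_spec (with_cand c d) e (fun t => LetSnd t A w) (letsnd_adj w).
Proof.
move=> eM lw.
have ev t : halts (with_cand c d) t -> exists p q, evl t = WPair p q /\
    eqv e (LetSnd t A w) (subst1 q w).
  move=> /halts_dom [et [p [q [er hp hq]]]]; exists p, q; split=> //.
  rewrite er in et.
  by apply: halts_expand (linear_map_halts lw hq) => v; exact: E_letsnd et.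
split=> [t /ev[p [q [_ /eqv_l]]]//|h hh]; split.
  exists (fun _ => 0), (fun p => h (evl (subst1 p w))); split=> //.
    exact: linear_on0.
  exact: (linear_map_tst eM lw).
by move=> t /ev[p [q [-> [_ _ ->]]]] //=; rewrite add0r.
Qed.

Lemma map_leaves_spec (L : term S -> Prop) e f g v : is_module e ->
  (forall p, L p -> is_leaf p /\ halts e (f p)) -> leaves L v ->
  halts e (map_leaves f v) /\
  forall h, tst e h -> (forall p, L p -> h (evl (f p)) = g p) ->
    h (evl (map_leaves f v)) = fold_leaves g v.
Proof.
move=> eM Lf.
have leaf t : L t -> map_leaves f t = f t /\ fold_leaves g t = g t.
  by move=> /Lf [+ _]; case: t.
have base t : L t -> halts e (map_leaves f t) /\
    forall h, tst e h -> (forall p, L p -> h (evl (f p)) = g p) ->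
    h (evl (map_leaves f t)) = fold_leaves g t.
  move=> Lt; have [-> ->] := leaf t Lt; split; first by case: (Lf t Lt).
  by move=> h _; apply.
elim: v => //=;
  try by move=> *; match goal with H : L ?p |- _ => exact: (base p H) end.
  move=> t IHt u IHu [/IHt[ht et] /IHu[hu eu]]; split; first exact: halts_sum.
  by move=> h hh hg; rewrite (tst_sum eM) // et ?eu.
move=> a t IHt /IHt[ht et]; split; first exact: halts_scal.
by move=> h hh hg; rewrite (tst_scal eM) // et.
Qed.

Lemma leaf_elim_spec (L : term S -> Prop) T e f E
    (G : (term S -> S) -> term S -> S) :
  is_module e ->
  (forall t v w, eval t v -> eval (map_leaves f v) w -> eval (E t) w) ->
  (forall p, L p -> is_leaf p /\ halts e (f p)) ->
  (forall h p, tst e h -> L p -> h (evl (f p)) = G h p) ->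
  (forall h, tst e h -> T (G h)) ->
  elim_spec (leaf_cand L T) e E (fun h => fold_leaves (G h)).
Proof.
move=> eM evE Lf LG TG.
have ev t : halts (leaf_cand L T) t -> eqv e (E t) (map_leaves f (evl t)).
  move=> /halts_dom [et dt]; apply: halts_expand => [v|]; first exact: evE et.
  (* Only the halting half is used, so the functional supplied is a dummy. *)
  by have [] := map_leaves_spec (G (fun _ => 0)) eM Lf dt.
split=> [t /ev /eqv_l //|h hh]; split; first by exists (G h) => //; apply: TG.
move=> t ht; have [_ _ -> //] := ev t ht; have [_ dt] := halts_dom ht.
have [_ ->] // := map_leaves_spec (G h) eM Lf dt.
by move=> p Lp; exact: LG.
Qed.

Lemma lettensor_spec A B c d e w : is_module e ->
  (forall q, halts d q -> linear_map c e (fun p => subst2 p q w)) ->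
  (forall p, halts c p -> linear_map d e (fun q => subst2 p q w)) ->
  elim_spec (tensor_cand c d) e (fun t => LetTensor t A B w) (lettensor_adj w).
Proof.
move=> eM l1 l2; apply: (leaf_elim_spec (f := lettensor_leaf A B w)) => //.
- by move=> t v x; exact: E_lettensor.
- move=> _ [p [q [-> hp hq]]]; split=> //=.
  exact: (linear_map_halts (l1 q hq)).
- by move=> h _ hh [p [q [-> hp hq]]].
- move=> h hh; exists (fun p q => h (evl (subst2 p q w))) => //; split.
    by move=> p hp; exact: (linear_map_tst eM (l2 p hp) hh).
  by move=> q hq; exact: (linear_map_tst eM (l1 q hq) hh).
Qed.

Lemma case_spec A B c d e w1 w2 : is_module e ->
  linear_map c e (fun p => subst1 p w1) ->
  linear_map d e (fun q => subst1 q w2) ->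
  elim_spec (plus_cand c d) e (fun t => Case t A w1 B w2) (case_adj w1 w2).
Proof.
move=> eM l1 l2; apply: (leaf_elim_spec (f := case_leaf A w1 B w2)) => //.
- by move=> t v x; exact: E_case.
- move=> _ [[p -> hp]|[q -> hq]]; split=> //=.
    exact: (linear_map_halts l1).
  exact: (linear_map_halts l2).
- by move=> h _ hh [[p -> hp]|[q -> hq]].
- move=> h hh; do 2 eexists; split; last by reflexivity.
    exact: (linear_map_tst eM l1).
  exact: (linear_map_tst eM l2).
Qed.

Lemma letbang_spec A c e w : is_module e ->
  (forall p q, eqv c p q -> eqv e (subst1 p w) (subst1 q w)) ->
  elim_spec (bang_cand c) e (fun t => LetBang t A w) (letbang_adj w).
Proof.
move=> eM rw; apply: (leaf_elim_spec (f := letbang_leaf A w)) => //.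
- by move=> t v x; exact: E_letbang.
- by move=> _ [p -> hp]; split=> //=; exact: (eqv_l (rw _ _ (eqv_refl hp))).
- by move=> h _ hh [p -> hp].
- move=> h hh; exists (fun p => h (evl (subst1 p w))) => // p q /rw[_ _].
  by apply.
Qed.

End Candidates.

(** * Semantics of terms *)

Section Soundness.
Variable S : comPzSemiRingType.
Implicit Types (t u v w : term S) (s : nat -> term S) (G : nat -> proposition).
Local Notation I := (interp S).
Local Notation M A := (@interp_module S A).

Definition related G s s' : Prop := forall i, eqv (I (G i)) (s i) (s' i).

Definition sem_eq G t u A : Prop :=
  forall s s', related G s s' -> eqv (I A) (subst s t) (subst s' u).

Definition upd i x s : nat -> term S := fun j => if j == i then x else s j.

Definition sem_lin G i t A : Prop :=
  forall s a b p q, related G s s -> halts (I (G i)) p -> halts (I (G i)) q ->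
    eqv (I A) (subst (upd i (comb a b p q) s) t)
      (comb a b (subst (upd i p s) t) (subst (upd i q s) t)).

Lemma related_sym G s s' : related G s s' -> related G s' s.
Proof. by move=> e i; apply: eqv_sym. Qed.

Lemma related_l G s s' : related G s s' -> related G s s.
Proof. by move=> e i; case: (e i). Qed.

Lemma related_r G s s' : related G s s' -> related G s' s'.
Proof. by move=> /related_sym /related_l. Qed.

Lemma related_scons G A s s' p p' : eqv (I A) p p' -> related G s s' ->
  related (scons A G) (scons p s) (scons p' s').
Proof. by move=> pp' ss' [|i] /=. Qed.

Lemma related_upd G i p s : halts (I (G i)) p -> related G s s ->
  related G (upd i p s) (upd i p s).
Proof. by move=> hp ss j; rewrite /upd; case: eqP => [->|_]. Qed.

Lemma scons_upd i x p s : scons p (upd i x s) = upd i.+1 x (scons p s).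
Proof. by apply: functional_extensionality => -[|j]. Qed.

Lemma upd0_scons x p s : upd 0 x (scons p s) = scons x s.
Proof. by apply: functional_extensionality => -[|j]. Qed.

Lemma upd1_scons x p q s : upd 1 x (scons q (scons p s)) = scons q (scons x s).
Proof. by apply: functional_extensionality => -[|[|j]]. Qed.

Lemma subst_upd_notin i x s t : ~~ fv i t -> subst (upd i x s) t = subst s t.
Proof.
move=> it; apply: eq_subst => j; rewrite /upd; case: eqP => // -> jt.
by rewrite jt in it.
Qed.

Lemma subst_up_upd_notin i x s t : ~~ fv i.+1 t ->
  subst (up_subst (upd i x s)) t = subst (up_subst s) t.
Proof.
move=> it; apply: eq_subst => -[|j] // jt; rewrite !up_substS /upd.
by case: eqP jt it => // -> ->.
Qed.

Lemma subst_up2_upd_notin i x s t : ~~ fv i.+2 t ->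
  subst (up_subst (up_subst (upd i x s))) t =
  subst (up_subst (up_subst s)) t.
Proof.
move=> it; apply: eq_subst => -[|[|j]] // jt; rewrite !up_substS /upd.
by case: eqP jt it => // -> ->.
Qed.

Lemma sem_eq_sym G t u A : sem_eq G t u A -> sem_eq G u t A.
Proof. by move=> tu s s' /related_sym ss'; apply: eqv_sym; apply: tu. Qed.

Lemma sem_eq_r G t u A : sem_eq G t u A -> sem_eq G u u A.
Proof.
move=> tu s s' ss'; apply: eqv_trans (tu _ _ ss').
by apply: eqv_sym; apply: tu; apply: related_l ss'.
Qed.

Lemma sem_eq_l G t u A : sem_eq G t u A -> sem_eq G t t A.
Proof. by move=> /sem_eq_sym /sem_eq_r. Qed.

Lemma sem_lin_eq G i t u A :
  sem_eq G t u A -> sem_lin G i t A -> sem_lin G i u A.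
Proof.
move=> tu lt s a b p q ss hp hq.
have hc := halts_comb (M (G i)) a b hp hq.
apply: eqv_trans (eqv_sym (tu _ _ (related_upd hc ss))) _.
apply: eqv_trans (lt s a b p q ss hp hq) _.
by apply: (eqv_comb (M A)); apply: tu; apply: related_upd.
Qed.

Lemma sem_eq_halts G t A s : sem_eq G t t A -> related G s s ->
  halts (I A) (subst s t).
Proof. by move=> tt ss; apply: eqv_l (tt _ _ ss). Qed.

(** * Bodies of binders as maps between interpretations *)

Section Bodies.
Variables (G : nat -> proposition) (A B C : proposition).

Lemma body_eqv w w' s s' p p' : sem_eq (scons A G) w w' C -> related G s s' ->
  eqv (I A) p p' ->
  eqv (I C) (subst1 p (subst (up_subst s) w))
    (subst1 p' (subst (up_subst s') w')).
Proof. by move=> ww ss pp; rewrite !subst1_up; apply/ww/related_scons. Qed.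

Lemma body_linear_map w s : sem_eq (scons A G) w w C ->
  sem_lin (scons A G) 0 w C -> related G s s ->
  linear_map (I A) (I C) (fun p => subst1 p (subst (up_subst s) w)).
Proof.
move=> ew lw ss; split=> [p q|a b p q hp hq]; first exact: body_eqv.
(* The entry [p] of [scons p s] is a placeholder that [upd 0] overwrites. *)
have := lw (scons p s) a b p q (related_scons (eqv_refl hp) ss) hp hq.
by rewrite !upd0_scons !subst1_up.
Qed.

Lemma body_comb i w s a b p q x : sem_lin (scons A G) i.+1 w C ->
  related G s s -> halts (I (G i)) p -> halts (I (G i)) q -> halts (I A) x ->
  eqv (I C) (subst1 x (subst (up_subst (upd i (comb a b p q) s)) w))
    (comb a b (subst1 x (subst (up_subst (upd i p s)) w))
              (subst1 x (subst (up_subst (upd i q s)) w))).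
Proof.
move=> lw ss hp hq hx; rewrite !subst1_up !scons_upd.
by apply: lw => //; apply: related_scons.
Qed.

Lemma body2_eqv w w' s s' p p' q q' : sem_eq (scons B (scons A G)) w w' C ->
  related G s s' -> eqv (I A) p p' -> eqv (I B) q q' ->
  eqv (I C) (subst2 p q (subst (up_subst (up_subst s)) w))
            (subst2 p' q' (subst (up_subst (up_subst s')) w')).
Proof.
move=> ww ss pp qq; rewrite !subst2_up; apply: ww.
exact: related_scons qq (related_scons pp ss).
Qed.

Lemma body2_linear_map_fst w s q : sem_eq (scons B (scons A G)) w w C ->
  sem_lin (scons B (scons A G)) 1 w C -> related G s s -> halts (I B) q ->
  linear_map (I A) (I C)
    (fun p => subst2 p q (subst (up_subst (up_subst s)) w)).
Proof.
move=> ew lw ss hq; split=> [p p' pp|a b p p' hp hp'].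
  exact: (body2_eqv ew ss pp (eqv_refl hq)).
have ss' := related_scons (eqv_refl hq) (related_scons (eqv_refl hp) ss).
by have := lw _ a b p p' ss' hp hp'; rewrite !upd1_scons !subst2_up.
Qed.

Lemma body2_linear_map_snd w s p : sem_eq (scons B (scons A G)) w w C ->
  sem_lin (scons B (scons A G)) 0 w C -> related G s s -> halts (I A) p ->
  linear_map (I B) (I C)
    (fun q => subst2 p q (subst (up_subst (up_subst s)) w)).
Proof.
move=> ew lw ss hp; split=> [q q' qq|a b q q' hq hq'].
  exact: (body2_eqv ew ss (eqv_refl hp) qq).
have ss' := related_scons (eqv_refl hq) (related_scons (eqv_refl hp) ss).
by have := lw _ a b q q' ss' hq hq'; rewrite !upd0_scons !subst2_up.
Qed.

Lemma body2_comb i w s a b p q x y : sem_lin (scons B (scons A G)) i.+2 w C ->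
  related G s s -> halts (I (G i)) p -> halts (I (G i)) q ->
  halts (I A) x -> halts (I B) y ->
  eqv (I C)
    (subst2 x y (subst (up_subst (up_subst (upd i (comb a b p q) s))) w))
    (comb a b (subst2 x y (subst (up_subst (up_subst (upd i p s))) w))
              (subst2 x y (subst (up_subst (up_subst (upd i q s))) w))).
Proof.
move=> lw ss hp hq hx hy; rewrite !subst2_up !scons_upd.
apply: lw => //.
exact: related_scons (eqv_refl hy) (related_scons (eqv_refl hx) ss).
Qed.

End Bodies.

Lemma fold_leaves_eq (L : term S -> Prop) g g' v :
  (forall p, L p -> g p = g' p) ->
  leaves L v -> fold_leaves g v = fold_leaves g' v.
Proof.
move=> gg'; elim: v => /=; intros; auto.
  by case: H1 => /H -> /H0 ->.
by rewrite H.
Qed.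

Lemma fold_leaves_comb (L : term S -> Prop) g g1 g2 a b v :
  (forall p, L p -> g p = a * g1 p + b * g2 p) -> leaves L v ->
  fold_leaves g v = a * fold_leaves g1 v + b * fold_leaves g2 v.
Proof.
move=> gg; elim: v => /=; intros; auto.
  by case: H1 => /H -> /H0 ->; rewrite !mulrDr addrACA.
by rewrite H // mulrDr mulrCA [s * (b * _)]mulrCA.
Qed.

Lemma eqv_comb_tst c t a b u v k : is_module c -> tst c k ->
  halts c u -> halts c v -> eqv c t (comb a b u v) ->
  k (evl t) = a * k (evl u) + b * k (evl v).
Proof. by move=> cM hk hu hv [_ _ ->] //; rewrite (tst_comb cM). Qed.

(** * Compatibility of the equivalence with the term formers *)

Lemma sem_eq_sum G t t' u u' A : sem_eq G t t' A -> sem_eq G u u' A ->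
  sem_eq G (Sum t u) (Sum t' u') A.
Proof. by move=> et eu s s' ss /=; apply: (eqv_sum (M A)); auto. Qed.

Lemma sem_eq_scal G a t t' A : sem_eq G t t' A ->
  sem_eq G (Scal a t) (Scal a t') A.
Proof. by move=> et s s' ss /=; apply: (eqv_scal (M A)); auto. Qed.

Lemma sem_letone_spec G u A s : sem_eq G u u A -> related G s s ->
  elim_spec (I One) (I A) (fun t => LetOne t (subst s u))
    (letone_adj (subst s u)).
Proof. by move=> eu ss; apply: letone_spec (M A) (sem_eq_halts eu ss). Qed.

Lemma sem_app_spec G u A B s : sem_eq G u u A -> related G s s ->
  elim_spec (I (Lolli A B)) (I B) (fun t => App t (subst s u))
    (app_adj (subst s u)).
Proof. by move=> eu ss; apply: app_spec (sem_eq_halts eu ss). Qed.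

Lemma sem_lettensor_spec G A B w C s : sem_eq (scons B (scons A G)) w w C ->
  sem_lin (scons B (scons A G)) 0 w C -> sem_lin (scons B (scons A G)) 1 w C ->
  related G s s ->
  elim_spec (I (Tensor A B)) (I C)
    (fun t => LetTensor t A B (subst (up_subst (up_subst s)) w))
    (lettensor_adj (subst (up_subst (up_subst s)) w)).
Proof.
move=> ew l0 l1 ss; apply: lettensor_spec (M C) _ _ => [q hq|p hp].
  exact: (body2_linear_map_fst ew l1 ss hq).
exact: (body2_linear_map_snd ew l0 ss hp).
Qed.

Lemma sem_letfst_spec G A B w C s : sem_eq (scons A G) w w C ->
  sem_lin (scons A G) 0 w C -> related G s s ->
  elim_spec (I (With A B)) (I C) (fun t => LetFst t A (subst (up_subst s) w))
    (letfst_adj (subst (up_subst s) w)).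
Proof.
by move=> ew l0 ss; apply: letfst_spec (M C) (body_linear_map ew l0 ss).
Qed.

Lemma sem_letsnd_spec G A B w C s : sem_eq (scons B G) w w C ->
  sem_lin (scons B G) 0 w C -> related G s s ->
  elim_spec (I (With A B)) (I C) (fun t => LetSnd t B (subst (up_subst s) w))
    (letsnd_adj (subst (up_subst s) w)).
Proof.
by move=> ew l0 ss; apply: letsnd_spec (M C) (body_linear_map ew l0 ss).
Qed.

Lemma sem_case_spec G A B w x C s :
  sem_eq (scons A G) w w C -> sem_lin (scons A G) 0 w C ->
  sem_eq (scons B G) x x C -> sem_lin (scons B G) 0 x C -> related G s s ->
  elim_spec (I (Plus A B)) (I C)
    (fun t => Case t A (subst (up_subst s) w) B (subst (up_subst s) x))
    (case_adj (subst (up_subst s) w) (subst (up_subst s) x)).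
Proof.
move=> ew lw ex lx ss.
exact: case_spec (M C) (body_linear_map ew lw ss) (body_linear_map ex lx ss).
Qed.

Lemma sem_letbang_spec G A w C s : sem_eq (scons A G) w w C -> related G s s ->
  elim_spec (I (Bang A)) (I C) (fun t => LetBang t A (subst (up_subst s) w))
    (letbang_adj (subst (up_subst s) w)).
Proof.
by move=> ew ss; apply: letbang_spec (M C) _ => p q; exact: body_eqv ew ss.
Qed.

Lemma sem_eq_letone G t t' u u' A : sem_eq G t t' One -> sem_eq G u u' A ->
  sem_eq G (LetOne t u) (LetOne t' u') A.
Proof.
move=> et eu s s' ss /=; have [hu hu' euu] := eu s s' ss.
apply: (elim_eqv (sem_letone_spec (sem_eq_l eu) (related_l ss))
  (sem_letone_spec (sem_eq_r eu) (related_r ss)) _ (et _ _ ss)).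
by move=> h _ hh [a ->] /=; rewrite !(tst_scal (M A)) ?euu.
Qed.

Lemma halts_lam A B r : linear_map (I A) (I B) (fun u => subst1 u r) ->
  halts (I (Lolli A B)) (Lam A r).
Proof. by move=> lr; exists (Lam A r); [constructor | exists r]. Qed.

(** A value of [Lolli] must have a linear body, so even termination of the abstractions rests on
    [sem_lin]; [sem_lin_eq] passes it from [t] to [t']. *)
Lemma sem_eq_lam G A t t' B : sem_eq (scons A G) t t' B ->
  sem_lin (scons A G) 0 t B -> sem_eq G (Lam A t) (Lam A t') (Lolli A B).
Proof.
move=> et lt s s' ss /=; have lt' := sem_lin_eq et lt; split.
- exact/halts_lam/(body_linear_map (sem_eq_l et) lt (related_l ss)).
- exact/halts_lam/(body_linear_map (sem_eq_r et) lt' (related_r ss)).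
- move=> _ [u [h [hu hh ->]]]; rewrite !(evl_intro (t := Lam _ _) isT) /=.
  have [_ _ e] := body_eqv et ss (eqv_refl hu); exact: (e h hh).
Qed.

Lemma sem_eq_app G t t' u u' A B : sem_eq G t t' (Lolli A B) ->
  sem_eq G u u' A -> sem_eq G (App t u) (App t' u') B.
Proof.
move=> et eu s s' ss /=; have uu := eu s s' ss.
apply: (elim_eqv (sem_app_spec B (sem_eq_l eu) (related_l ss))
  (sem_app_spec B (sem_eq_r eu) (related_r ss)) _ (et _ _ ss)).
by move=> h _ hh [r -> [rr _]] /=; have [_ _ e] := rr _ _ uu; exact: (e h hh).
Qed.

Lemma sem_eq_tpair G t t' u u' A B : sem_eq G t t' A -> sem_eq G u u' B ->
  sem_eq G (TPair t u) (TPair t' u') (Tensor A B).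
Proof.
move=> et eu s s' ss /=; have [tt uu] := (et s s' ss, eu s s' ss).
have [[ht ht' _] [hu hu' _]] := (tt, uu).
split; try by eexists; [constructor | do 2 eexists].
move=> _ [_ [beta [b1 b2] ->] ->]; rewrite !evl_intro //=.
by rewrite ((b1 _ ht).1 _ _ uu) ((b2 _ hu').1 _ _ tt).
Qed.

Lemma sem_eq_lettensor G t t' A B w w' C : sem_eq G t t' (Tensor A B) ->
  sem_eq (scons B (scons A G)) w w' C ->
  sem_lin (scons B (scons A G)) 0 w C -> sem_lin (scons B (scons A G)) 1 w C ->
  sem_eq G (LetTensor t A B w) (LetTensor t' A B w') C.
Proof.
move=> et ew l0 l1 s s' ss /=.
have [ss1 ss2] := (related_l ss, related_r ss).
have [ew1 ew2] := (sem_eq_l ew, sem_eq_r ew).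
apply: (elim_eqv (sem_lettensor_spec ew1 l0 l1 ss1)
  (sem_lettensor_spec ew2 (sem_lin_eq ew l0) (sem_lin_eq ew l1) ss2) _
  (et _ _ ss)) => h v hh.
apply: fold_leaves_eq => _ [p [q [-> hp hq]]].
have [_ _ e] := body2_eqv ew ss (eqv_refl hp) (eqv_refl hq); exact: (e h hh).
Qed.

Lemma sem_eq_wpair G t t' u u' A B : sem_eq G t t' A -> sem_eq G u u' B ->
  sem_eq G (WPair t u) (WPair t' u') (With A B).
Proof.
move=> et eu s s' ss /=; have [tt uu] := (et s s' ss, eu s s' ss).
have [[ht ht' _] [hu hu' _]] := (tt, uu).
split; try by eexists; [constructor | do 2 eexists].
move=> _ [phi [psi [[rphi _] [rpsi _] ->]]]; rewrite !evl_intro //=.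
by rewrite (rphi _ _ tt) (rpsi _ _ uu).
Qed.

Lemma sem_eq_letfst G t t' A B w w' C : sem_eq G t t' (With A B) ->
  sem_eq (scons A G) w w' C -> sem_lin (scons A G) 0 w C ->
  sem_eq G (LetFst t A w) (LetFst t' A w') C.
Proof.
move=> et ew l0 s s' ss /=.
have [ss1 ss2] := (related_l ss, related_r ss).
have [ew1 ew2] := (sem_eq_l ew, sem_eq_r ew).
apply: (elim_eqv (sem_letfst_spec _ ew1 l0 ss1)
  (sem_letfst_spec _ ew2 (sem_lin_eq ew l0) ss2) _ (et _ _ ss)).
move=> h _ hh [p [q [-> hp _]]] /=.
have [_ _ e] := body_eqv ew ss (eqv_refl hp); by rewrite (e h hh).
Qed.

Lemma sem_eq_letsnd G t t' A B w w' C : sem_eq G t t' (With A B) ->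
  sem_eq (scons B G) w w' C -> sem_lin (scons B G) 0 w C ->
  sem_eq G (LetSnd t B w) (LetSnd t' B w') C.
Proof.
move=> et ew l0 s s' ss /=.
have [ss1 ss2] := (related_l ss, related_r ss).
have [ew1 ew2] := (sem_eq_l ew, sem_eq_r ew).
apply: (elim_eqv (sem_letsnd_spec _ ew1 l0 ss1)
  (sem_letsnd_spec _ ew2 (sem_lin_eq ew l0) ss2) _ (et _ _ ss)).
move=> h _ hh [p [q [-> _ hq]]] /=.
have [_ _ e] := body_eqv ew ss (eqv_refl hq); by rewrite (e h hh).
Qed.

Lemma sem_eq_inl G t t' A B : sem_eq G t t' A ->
  sem_eq G (Inl t) (Inl t') (Plus A B).
Proof.
move=> et s s' ss /=; have tt := et s s' ss; have [ht ht' _] := tt.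
split; try by eexists; [constructor | left; eexists].
move=> _ [_ [phi [psi [[rphi _] _ ->]]] ->]; rewrite !evl_intro //=.
exact: rphi.
Qed.

Lemma sem_eq_inr G t t' A B : sem_eq G t t' B ->
  sem_eq G (Inr t) (Inr t') (Plus A B).
Proof.
move=> et s s' ss /=; have tt := et s s' ss; have [ht ht' _] := tt.
split; try by eexists; [constructor | right; eexists].
move=> _ [_ [phi [psi [_ [rpsi _] ->]]] ->]; rewrite !evl_intro //=.
exact: rpsi.
Qed.

Lemma sem_eq_case G t t' A B w w' x x' C : sem_eq G t t' (Plus A B) ->
  sem_eq (scons A G) w w' C -> sem_lin (scons A G) 0 w C ->
  sem_eq (scons B G) x x' C -> sem_lin (scons B G) 0 x C ->
  sem_eq G (Case t A w B x) (Case t' A w' B x') C.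
Proof.
move=> et ew lw ex lx s s' ss /=.
have [ss1 ss2] := (related_l ss, related_r ss).
have [ew1 ew2] := (sem_eq_l ew, sem_eq_r ew).
have [ex1 ex2] := (sem_eq_l ex, sem_eq_r ex).
apply: (elim_eqv (sem_case_spec ew1 lw ex1 lx ss1)
  (sem_case_spec ew2 (sem_lin_eq ew lw) ex2 (sem_lin_eq ex lx) ss2) _
  (et _ _ ss)) => h v hh.
apply: fold_leaves_eq => _ [[p -> hp]|[q -> hq]].
  have [_ _ e] := body_eqv ew ss (eqv_refl hp); exact: (e h hh).
have [_ _ e] := body_eqv ex ss (eqv_refl hq); exact: (e h hh).
Qed.

Lemma sem_eq_promote G t t' A : sem_eq G t t' A ->
  sem_eq G (Promote t) (Promote t') (Bang A).
Proof.
move=> et s s' ss /=; have tt := et s s' ss; have [ht ht' _] := tt.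
split; try by eexists; [constructor | eexists].
move=> _ [_ [phi rphi ->] ->]; rewrite !evl_intro //=; exact: rphi.
Qed.

Lemma sem_eq_letbang G t t' A w w' C : sem_eq G t t' (Bang A) ->
  sem_eq (scons A G) w w' C -> sem_eq G (LetBang t A w) (LetBang t' A w') C.
Proof.
move=> et ew s s' ss /=.
have [ss1 ss2] := (related_l ss, related_r ss).
have [ew1 ew2] := (sem_eq_l ew, sem_eq_r ew).
apply: (elim_eqv (sem_letbang_spec ew1 ss1) (sem_letbang_spec ew2 ss2) _
  (et _ _ ss)) => h v hh.
apply: fold_leaves_eq => _ [p -> hp].
have [_ _ e] := body_eqv ew ss (eqv_refl hp); exact: (e h hh).
Qed.

Lemma halts_Zero t : ~ halts (I Zero) t.
Proof. by case. Qed.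

(** Vacuous: [Zero] has no value, so no pair of related substitutions can exist for such a
    context. *)
Lemma sem_eq_absurd G t t' A : sem_eq G t t' Zero ->
  sem_eq G (Absurd t) (Absurd t') A.
Proof. by move=> et s s' /et /eqv_l /halts_Zero. Qed.

(** * Linearity in a variable consumed once *)

Lemma eqv_sum_comb c a b t1 t2 u1 u2 : is_module c ->
  halts c t1 -> halts c t2 -> halts c u1 -> halts c u2 ->
  eqv c (Sum (comb a b t1 t2) (comb a b u1 u2))
    (comb a b (Sum t1 u1) (Sum t2 u2)).
Proof.
move=> cM ht1 ht2 hu1 hu2.
have hc t u := @halts_comb _ c cM a b t u; have hs := @halts_sum _ c cM.
split=> [||k hk]; auto.
rewrite (tst_sum cM hk (hc _ _ ht1 ht2) (hc _ _ hu1 hu2)).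
rewrite !(tst_comb cM) //; auto.
by rewrite !(tst_sum cM) // !mulrDr addrACA.
Qed.

Lemma eqv_scal_comb c x a b t u : is_module c -> halts c t -> halts c u ->
  eqv c (Scal x (comb a b t u)) (comb a b (Scal x t) (Scal x u)).
Proof.
move=> cM ht hu; have hc := halts_comb cM a b ht hu.
have hs t' := @halts_scal _ c cM x t'.
split=> [||k hk]; first exact: hs.
  by apply: (halts_comb cM); apply: hs.
rewrite (tst_scal cM x hk hc) !(tst_comb cM) //; auto.
by rewrite !(tst_scal cM) // mulrDr mulrCA [x * (b * _)]mulrCA.
Qed.

Lemma sem_lin_sum G i t u A : sem_eq G t t A -> sem_eq G u u A ->
  sem_lin G i t A -> sem_lin G i u A -> sem_lin G i (Sum t u) A.
Proof.
move=> et eu lt lu s a b p q ss hp hq /=.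
have [rp rq] := (related_upd hp ss, related_upd hq ss).
have [lts lus] := (lt s a b p q ss hp hq, lu s a b p q ss hp hq).
apply: eqv_trans (eqv_sum (M A) lts lus) _.
exact: eqv_sum_comb (M A) (sem_eq_halts et rp) (sem_eq_halts et rq)
  (sem_eq_halts eu rp) (sem_eq_halts eu rq).
Qed.

Lemma sem_lin_scal G i x t A : sem_eq G t t A -> sem_lin G i t A ->
  sem_lin G i (Scal x t) A.
Proof.
move=> et lt s a b p q ss hp hq /=.
have [rp rq] := (related_upd hp ss, related_upd hq ss).
apply: eqv_trans (eqv_scal (M A) x (lt s a b p q ss hp hq)) _.
exact: eqv_scal_comb (M A) (sem_eq_halts et rp) (sem_eq_halts et rq).
Qed.

(** Pattern of all the eliminations with the variable in the principal term: the body ignores the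
    substituted value, and [elim_comb] applies. *)
Lemma sem_lin_letone_l G i t u A : sem_eq G t t One -> sem_eq G u u A ->
  sem_lin G i t One -> ~~ fv i u -> sem_lin G i (LetOne t u) A.
Proof.
move=> et eu lt iu s a b p q ss hp hq /=; rewrite !(subst_upd_notin _ _ iu).
apply: (elim_comb (M One) (M A) (sem_letone_spec eu ss)); last exact: lt.
  exact: sem_eq_halts et (related_upd hp ss).
exact: sem_eq_halts et (related_upd hq ss).
Qed.

(** Pattern of all the eliminations with the variable on the side: three substitutions give three
    eliminations of one principal term, and [elim_comb_body] asks for a relation between their
    adjoints on its value. *)
Lemma sem_lin_letone_r G i t u A : sem_eq G t t One -> sem_eq G u u A ->
  ~~ fv i t -> sem_lin G i u A -> sem_lin G i (LetOne t u) A.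
Proof.
move=> et eu it lu s a b p q ss hp hq /=; rewrite !(subst_upd_notin _ _ it).
have hc := halts_comb (M (G i)) a b hp hq.
have [rp rq] := (related_upd hp ss, related_upd hq ss).
have [hup huq] := (sem_eq_halts eu rp, sem_eq_halts eu rq).
apply: (elim_comb_body (M A) (sem_letone_spec eu (related_upd hc ss))
  (sem_letone_spec eu rp) (sem_letone_spec eu rq) _ (sem_eq_halts et ss)).
move=> h _ hh [x ->] /=.
have [hxp hxq] := (halts_scal (M A) x hup, halts_scal (M A) x huq).
apply: (eqv_comb_tst (M A) hh hxp hxq).
apply: eqv_trans (eqv_scal (M A) x (lu s a b p q ss hp hq)) _.
exact: eqv_scal_comb (M A) hup huq.
Qed.

Lemma sem_lin_lam G i A t B : sem_eq (scons A G) t t B ->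
  sem_lin (scons A G) 0 t B -> sem_lin (scons A G) i.+1 t B ->
  sem_lin G i (Lam A t) (Lolli A B).
Proof.
move=> et l0 lt s a b p q ss hp hq /=.
have hc := halts_comb (M (G i)) a b hp hq.
have hL x : halts (I (G i)) x ->
    halts (I (Lolli A B)) (Lam A (subst (up_subst (upd i x s)) t)).
  by move=> hx; apply/halts_lam/(body_linear_map et l0)/related_upd.
split=> [||k hk]; first exact: hL.
  by apply: (halts_comb (M (Lolli A B))); apply: hL.
rewrite (tst_comb (M (Lolli A B)) a b hk (hL p hp) (hL q hq)).
case: hk => u [h [hu hh ->]].
rewrite !(evl_intro (t := Lam _ _) isT) /=.
apply: (eqv_comb_tst (M B) hh); last exact: (body_comb a b lt ss hp hq hu).
  exact: eqv_l (body_eqv et (related_upd hp ss) (eqv_refl hu)).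
exact: eqv_l (body_eqv et (related_upd hq ss) (eqv_refl hu)).
Qed.

Lemma sem_lin_app_l G i t u A B : sem_eq G t t (Lolli A B) -> sem_eq G u u A ->
  sem_lin G i t (Lolli A B) -> ~~ fv i u -> sem_lin G i (App t u) B.
Proof.
move=> et eu lt iu s a b p q ss hp hq /=; rewrite !(subst_upd_notin _ _ iu).
apply: (elim_comb (M (Lolli A B)) (M B) (sem_app_spec B eu ss)); last exact: lt.
  exact: sem_eq_halts et (related_upd hp ss).
exact: sem_eq_halts et (related_upd hq ss).
Qed.

Lemma sem_lin_app_r G i t u A B : sem_eq G t t (Lolli A B) -> sem_eq G u u A ->
  ~~ fv i t -> sem_lin G i u A -> sem_lin G i (App t u) B.
Proof.
move=> et eu it lu s a b p q ss hp hq /=; rewrite !(subst_upd_notin _ _ it).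
have hc := halts_comb (M (G i)) a b hp hq.
have [rp rq] := (related_upd hp ss, related_upd hq ss).
have [hup huq] := (sem_eq_halts eu rp, sem_eq_halts eu rq).
apply: (elim_comb_body (M B) (sem_app_spec B eu (related_upd hc ss))
  (sem_app_spec B eu rp) (sem_app_spec B eu rq) _ (sem_eq_halts et ss)).
move=> h _ hh [r -> lr] /=; have [r1 r2] := lr.
have [hrp hrq] := (linear_map_halts lr hup, linear_map_halts lr huq).
apply: (eqv_comb_tst (M B) hh hrp hrq).
(* The value of [t] has a linear body: [r1] replaces the argument by a combination, [r2] distributes
   over it. *)
exact: eqv_trans (r1 _ _ (lu s a b p q ss hp hq)) (r2 a b _ _ hup huq).
Qed.

Lemma halts_tpair A B t u : halts (I A) t -> halts (I B) u ->
  halts (I (Tensor A B)) (TPair t u).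
Proof. by move=> ht hu; eexists; [constructor | do 2 eexists]. Qed.

Lemma halts_wpair A B t u : halts (I A) t -> halts (I B) u ->
  halts (I (With A B)) (WPair t u).
Proof. by move=> ht hu; eexists; [constructor | do 2 eexists]. Qed.

Lemma halts_inl A B t : halts (I A) t -> halts (I (Plus A B)) (Inl t).
Proof. by move=> ht; eexists; [constructor | left; eexists]. Qed.

Lemma halts_inr A B t : halts (I B) t -> halts (I (Plus A B)) (Inr t).
Proof. by move=> ht; eexists; [constructor | right; eexists]. Qed.

Lemma sem_lin_tpair_l G i t u A B : sem_eq G t t A -> sem_eq G u u B ->
  sem_lin G i t A -> ~~ fv i u -> sem_lin G i (TPair t u) (Tensor A B).
Proof.
move=> et eu lt iu s a b p q ss hp hq /=; rewrite !(subst_upd_notin _ _ iu).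
have hu := sem_eq_halts eu ss; have lts := lt s a b p q ss hp hq.
have htp := sem_eq_halts et (related_upd hp ss).
have htq := sem_eq_halts et (related_upd hq ss).
have [hPp hPq] := (halts_tpair htp hu, halts_tpair htq hu).
split; [exact: halts_tpair (eqv_l lts) hu
       |exact: (halts_comb (M (Tensor A B)))|move=> k hk].
rewrite (tst_comb (M (Tensor A B)) a b hk hPp hPq).
case: hk => _ [beta [_ b2] ->] ->.
rewrite !(evl_intro (t := TPair _ _) isT) /=.
by have [r l] := b2 _ hu; rewrite (r _ _ lts) l.
Qed.

Lemma sem_lin_tpair_r G i t u A B : sem_eq G t t A -> sem_eq G u u B ->
  ~~ fv i t -> sem_lin G i u B -> sem_lin G i (TPair t u) (Tensor A B).
Proof.
move=> et eu it lu s a b p q ss hp hq /=; rewrite !(subst_upd_notin _ _ it).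
have ht := sem_eq_halts et ss; have lus := lu s a b p q ss hp hq.
have hup := sem_eq_halts eu (related_upd hp ss).
have huq := sem_eq_halts eu (related_upd hq ss).
have [hPp hPq] := (halts_tpair ht hup, halts_tpair ht huq).
split; [exact: halts_tpair ht (eqv_l lus)
       |exact: (halts_comb (M (Tensor A B)))|move=> k hk].
rewrite (tst_comb (M (Tensor A B)) a b hk hPp hPq).
case: hk => _ [beta [b1 _] ->] ->.
rewrite !(evl_intro (t := TPair _ _) isT) /=.
by have [r l] := b1 _ ht; rewrite (r _ _ lus) l.
Qed.

Lemma sem_lin_lettensor_l G i t A B w C : sem_eq G t t (Tensor A B) ->
  sem_eq (scons B (scons A G)) w w C ->
  sem_lin (scons B (scons A G)) 0 w C -> sem_lin (scons B (scons A G)) 1 w C ->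
  sem_lin G i t (Tensor A B) -> ~~ fv i.+2 w ->
  sem_lin G i (LetTensor t A B w) C.
Proof.
move=> et ew l0 l1 lt iw s a b p q ss hp hq /=.
rewrite !(subst_up2_upd_notin _ _ iw).
apply: (elim_comb (M (Tensor A B)) (M C) (sem_lettensor_spec ew l0 l1 ss)).
- exact: sem_eq_halts et (related_upd hp ss).
- exact: sem_eq_halts et (related_upd hq ss).
- exact: lt.
Qed.

Lemma sem_lin_lettensor_r G i t A B w C : sem_eq G t t (Tensor A B) ->
  sem_eq (scons B (scons A G)) w w C ->
  sem_lin (scons B (scons A G)) 0 w C -> sem_lin (scons B (scons A G)) 1 w C ->
  ~~ fv i t -> sem_lin (scons B (scons A G)) i.+2 w C ->
  sem_lin G i (LetTensor t A B w) C.
Proof.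
move=> et ew l0 l1 it lw s a b p q ss hp hq /=.
rewrite !(subst_upd_notin _ _ it).
have hc := halts_comb (M (G i)) a b hp hq.
have [rp rq] := (related_upd hp ss, related_upd hq ss).
apply: (elim_comb_body (M C) (sem_lettensor_spec ew l0 l1 (related_upd hc ss))
  (sem_lettensor_spec ew l0 l1 rp) (sem_lettensor_spec ew l0 l1 rq) _
  (sem_eq_halts et ss)).
move=> h v hh; apply: fold_leaves_comb => _ [x [y [-> hx hy]]].
apply: (eqv_comb_tst (M C) hh); last exact: (body2_comb a b lw ss hp hq hx hy).
  exact: eqv_l (body2_eqv ew rp (eqv_refl hx) (eqv_refl hy)).
exact: eqv_l (body2_eqv ew rq (eqv_refl hx) (eqv_refl hy)).
Qed.

Lemma sem_lin_unit G i : sem_lin G i Unit Top.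
Proof.
have hU : halts (I Top) Unit by exists Unit; first constructor.
by move=> s a b p q _ _ _; split=> //; apply: (halts_comb (M Top)).
Qed.

Lemma sem_lin_absurd G i t A : sem_eq G t t Zero -> sem_lin G i (Absurd t) A.
Proof.
by move=> et s a b p q ss _ _; case: (halts_Zero (sem_eq_halts et ss)).
Qed.

Lemma sem_lin_wpair G i t u A B : sem_eq G t t A -> sem_eq G u u B ->
  sem_lin G i t A -> sem_lin G i u B -> sem_lin G i (WPair t u) (With A B).
Proof.
move=> et eu lt lu s a b p q ss hp hq /=.
have lts := lt s a b p q ss hp hq; have lus := lu s a b p q ss hp hq.
have [rp rq] := (related_upd hp ss, related_upd hq ss).
have [htp htq] := (sem_eq_halts et rp, sem_eq_halts et rq).
have [hup huq] := (sem_eq_halts eu rp, sem_eq_halts eu rq).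
have [hPp hPq] := (halts_wpair htp hup, halts_wpair htq huq).
split; [exact: halts_wpair (eqv_l lts) (eqv_l lus)
       |exact: (halts_comb (M (With A B)))|move=> k hk].
rewrite (tst_comb (M (With A B)) a b hk hPp hPq).
case: hk => phi [psi [[rphi lphi] [rpsi lpsi] ->]].
rewrite !(evl_intro (t := WPair _ _) isT) /=.
by rewrite (rphi _ _ lts) (rpsi _ _ lus) lphi // lpsi // !mulrDr addrACA.
Qed.

Lemma sem_lin_letfst_l G i t A B w C : sem_eq G t t (With A B) ->
  sem_eq (scons A G) w w C -> sem_lin (scons A G) 0 w C ->
  sem_lin G i t (With A B) -> ~~ fv i.+1 w -> sem_lin G i (LetFst t A w) C.
Proof.
move=> et ew l0 lt iw s a b p q ss hp hq /=.
rewrite !(subst_up_upd_notin _ _ iw).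
apply: (elim_comb (M (With A B)) (M C) (sem_letfst_spec B ew l0 ss)).
- exact: sem_eq_halts et (related_upd hp ss).
- exact: sem_eq_halts et (related_upd hq ss).
- exact: lt.
Qed.

Lemma sem_lin_letfst_r G i t A B w C : sem_eq G t t (With A B) ->
  sem_eq (scons A G) w w C -> sem_lin (scons A G) 0 w C ->
  ~~ fv i t -> sem_lin (scons A G) i.+1 w C -> sem_lin G i (LetFst t A w) C.
Proof.
move=> et ew l0 it lw s a b p q ss hp hq /=.
rewrite !(subst_upd_notin _ _ it).
have hc := halts_comb (M (G i)) a b hp hq.
have [rp rq] := (related_upd hp ss, related_upd hq ss).
apply: (elim_comb_body (M C) (sem_letfst_spec B ew l0 (related_upd hc ss))
  (sem_letfst_spec B ew l0 rp) (sem_letfst_spec B ew l0 rq) _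
  (sem_eq_halts et ss)).
move=> h _ hh [x [y [-> hx _]]] /=; rewrite !addr0.
apply: (eqv_comb_tst (M C) hh); last exact: (body_comb a b lw ss hp hq hx).
  exact: eqv_l (body_eqv ew rp (eqv_refl hx)).
exact: eqv_l (body_eqv ew rq (eqv_refl hx)).
Qed.

Lemma sem_lin_letsnd_l G i t A B w C : sem_eq G t t (With A B) ->
  sem_eq (scons B G) w w C -> sem_lin (scons B G) 0 w C ->
  sem_lin G i t (With A B) -> ~~ fv i.+1 w -> sem_lin G i (LetSnd t B w) C.
Proof.
move=> et ew l0 lt iw s a b p q ss hp hq /=.
rewrite !(subst_up_upd_notin _ _ iw).
apply: (elim_comb (M (With A B)) (M C) (sem_letsnd_spec A ew l0 ss)).
- exact: sem_eq_halts et (related_upd hp ss).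
- exact: sem_eq_halts et (related_upd hq ss).
- exact: lt.
Qed.

Lemma sem_lin_letsnd_r G i t A B w C : sem_eq G t t (With A B) ->
  sem_eq (scons B G) w w C -> sem_lin (scons B G) 0 w C ->
  ~~ fv i t -> sem_lin (scons B G) i.+1 w C -> sem_lin G i (LetSnd t B w) C.
Proof.
move=> et ew l0 it lw s a b p q ss hp hq /=.
rewrite !(subst_upd_notin _ _ it).
have hc := halts_comb (M (G i)) a b hp hq.
have [rp rq] := (related_upd hp ss, related_upd hq ss).
apply: (elim_comb_body (M C) (sem_letsnd_spec A ew l0 (related_upd hc ss))
  (sem_letsnd_spec A ew l0 rp) (sem_letsnd_spec A ew l0 rq) _
  (sem_eq_halts et ss)).
move=> h _ hh [x [y [-> _ hy]]] /=; rewrite !add0r.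
apply: (eqv_comb_tst (M C) hh); last exact: (body_comb a b lw ss hp hq hy).
  exact: eqv_l (body_eqv ew rp (eqv_refl hy)).
exact: eqv_l (body_eqv ew rq (eqv_refl hy)).
Qed.

Lemma sem_lin_inl G i t A B : sem_eq G t t A -> sem_lin G i t A ->
  sem_lin G i (Inl t) (Plus A B).
Proof.
move=> et lt s a b p q ss hp hq /=; have lts := lt s a b p q ss hp hq.
have htp := sem_eq_halts et (related_upd hp ss).
have htq := sem_eq_halts et (related_upd hq ss).
have [hIp hIq] := (halts_inl B htp, halts_inl B htq).
split; [exact: halts_inl (eqv_l lts)|exact: (halts_comb (M (Plus A B)))|].
move=> k hk; rewrite (tst_comb (M (Plus A B)) a b hk hIp hIq).
case: hk => _ [phi [psi [[r l] _ ->]]] ->.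
by rewrite !(evl_intro (t := Inl _) isT) /= (r _ _ lts) l.
Qed.

Lemma sem_lin_inr G i t A B : sem_eq G t t B -> sem_lin G i t B ->
  sem_lin G i (Inr t) (Plus A B).
Proof.
move=> et lt s a b p q ss hp hq /=; have lts := lt s a b p q ss hp hq.
have htp := sem_eq_halts et (related_upd hp ss).
have htq := sem_eq_halts et (related_upd hq ss).
have [hIp hIq] := (halts_inr A htp, halts_inr A htq).
split; [exact: halts_inr (eqv_l lts)|exact: (halts_comb (M (Plus A B)))|].
move=> k hk; rewrite (tst_comb (M (Plus A B)) a b hk hIp hIq).
case: hk => _ [phi [psi [_ [r l] ->]]] ->.
by rewrite !(evl_intro (t := Inr _) isT) /= (r _ _ lts) l.
Qed.

Lemma sem_lin_case_l G i t A B w x C : sem_eq G t t (Plus A B) ->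
  sem_eq (scons A G) w w C -> sem_lin (scons A G) 0 w C ->
  sem_eq (scons B G) x x C -> sem_lin (scons B G) 0 x C ->
  sem_lin G i t (Plus A B) -> ~~ fv i.+1 w -> ~~ fv i.+1 x ->
  sem_lin G i (Case t A w B x) C.
Proof.
move=> et ew lw ex lx lt iw ix s a b p q ss hp hq /=.
rewrite !(subst_up_upd_notin _ _ iw) !(subst_up_upd_notin _ _ ix).
apply: (elim_comb (M (Plus A B)) (M C) (sem_case_spec ew lw ex lx ss)).
- exact: sem_eq_halts et (related_upd hp ss).
- exact: sem_eq_halts et (related_upd hq ss).
- exact: lt.
Qed.

Lemma sem_lin_case_r G i t A B w x C : sem_eq G t t (Plus A B) ->
  sem_eq (scons A G) w w C -> sem_lin (scons A G) 0 w C ->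
  sem_eq (scons B G) x x C -> sem_lin (scons B G) 0 x C ->
  ~~ fv i t -> sem_lin (scons A G) i.+1 w C -> sem_lin (scons B G) i.+1 x C ->
  sem_lin G i (Case t A w B x) C.
Proof.
move=> et ew lw ex lx it liw lix s a b p q ss hp hq /=.
rewrite !(subst_upd_notin _ _ it).
have hc := halts_comb (M (G i)) a b hp hq.
have [rp rq] := (related_upd hp ss, related_upd hq ss).
apply: (elim_comb_body (M C) (sem_case_spec ew lw ex lx (related_upd hc ss))
  (sem_case_spec ew lw ex lx rp) (sem_case_spec ew lw ex lx rq) _
  (sem_eq_halts et ss)).
move=> h v hh; apply: fold_leaves_comb => _ [[y -> hy]|[y -> hy]].
  apply: (eqv_comb_tst (M C) hh); last exact: (body_comb a b liw ss hp hq hy).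
    exact: eqv_l (body_eqv ew rp (eqv_refl hy)).
  exact: eqv_l (body_eqv ew rq (eqv_refl hy)).
apply: (eqv_comb_tst (M C) hh); last exact: (body_comb a b lix ss hp hq hy).
  exact: eqv_l (body_eqv ex rp (eqv_refl hy)).
exact: eqv_l (body_eqv ex rq (eqv_refl hy)).
Qed.

Lemma sem_lin_letbang_l G i t A w C : sem_eq G t t (Bang A) ->
  sem_eq (scons A G) w w C -> sem_lin G i t (Bang A) -> ~~ fv i.+1 w ->
  sem_lin G i (LetBang t A w) C.
Proof.
move=> et ew lt iw s a b p q ss hp hq /=.
rewrite !(subst_up_upd_notin _ _ iw).
apply: (elim_comb (M (Bang A)) (M C) (sem_letbang_spec ew ss)).
- exact: sem_eq_halts et (related_upd hp ss).
- exact: sem_eq_halts et (related_upd hq ss).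
- exact: lt.
Qed.

Lemma sem_lin_letbang_r G i t A w C : sem_eq G t t (Bang A) ->
  sem_eq (scons A G) w w C -> ~~ fv i t -> sem_lin (scons A G) i.+1 w C ->
  sem_lin G i (LetBang t A w) C.
Proof.
move=> et ew it lw s a b p q ss hp hq /=.
rewrite !(subst_upd_notin _ _ it).
have hc := halts_comb (M (G i)) a b hp hq.
have [rp rq] := (related_upd hp ss, related_upd hq ss).
apply: (elim_comb_body (M C) (sem_letbang_spec ew (related_upd hc ss))
  (sem_letbang_spec ew rp) (sem_letbang_spec ew rq) _ (sem_eq_halts et ss)).
move=> h v hh; apply: fold_leaves_comb => _ [x -> hx].
apply: (eqv_comb_tst (M C) hh); last exact: (body_comb a b lw ss hp hq hx).
  exact: eqv_l (body_eqv ew rp (eqv_refl hx)).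
exact: eqv_l (body_eqv ew rq (eqv_refl hx)).
Qed.

Lemma sem_eq_var G i : sem_eq G (Var i) (Var i) (G i).
Proof. by move=> s s' ss; apply: ss. Qed.

Lemma sem_lin_var G i : sem_lin G i (Var i) (G i).
Proof.
move=> s a b p q _ hp hq; rewrite /= /upd eqxx.
exact/eqv_refl/(halts_comb (M (G i))).
Qed.

Lemma sem_eq_star G a : sem_eq G (Star a) (Star a) One.
Proof.
by move=> s s' _; apply: eqv_refl; exists (Star a); [constructor | exists a].
Qed.

Lemma sem_eq_unit G : sem_eq G Unit Unit Top.
Proof. by move=> s s' _; apply: eqv_refl; exists Unit; first constructor. Qed.

(** The two halves are inseparable: binders of linear variables need linearity of their bodies in
    order to halt, and every linearity lemma for a compound term needs its subterms to halt.
    [LetBang] asks only that its body respect [eqv], and [Promote] makes no linearity claim since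
    [lin] is false on it. *)
Lemma fundamental G t A : ltyped G t A ->
  sem_eq G t t A /\ forall i, lin i t -> sem_lin G i t A.
Proof.
elim=> {G t A} /=; intros;
  repeat match goal with H : _ /\ _ |- _ => case: H => ? ? end; split; intros;
  repeat match goal with
  | H : is_true (_ && _) |- _ => case/andP: H => *
  | H : is_true (_ || _) |- _ => case/orP: H => *
  | H : is_true (_ == _) |- _ => move/eqP: H => ?; subst
  end; try done;
  eauto using sem_eq_var, sem_lin_var, sem_eq_sum, sem_eq_scal, sem_eq_star,
    sem_eq_letone, sem_eq_lam, sem_eq_app, sem_eq_tpair, sem_eq_lettensor,
    sem_eq_unit, sem_eq_absurd, sem_eq_wpair, sem_eq_letfst, sem_eq_letsnd,
    sem_eq_inl, sem_eq_inr, sem_eq_case, sem_eq_promote, sem_eq_letbang,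
    sem_lin_sum, sem_lin_scal, sem_lin_letone_l, sem_lin_letone_r, sem_lin_lam,
    sem_lin_app_l, sem_lin_app_r, sem_lin_tpair_l, sem_lin_tpair_r,
    sem_lin_lettensor_l, sem_lin_lettensor_r, sem_lin_unit, sem_lin_absurd,
    sem_lin_wpair, sem_lin_letfst_l, sem_lin_letfst_r, sem_lin_letsnd_l,
    sem_lin_letsnd_r, sem_lin_inl, sem_lin_inr, sem_lin_case_l, sem_lin_case_r,
    sem_lin_letbang_l, sem_lin_letbang_r.
by apply: sem_lin_case_r; auto.
Qed.

End Soundness.

(** * Soundness of reduction for the equivalence *)

Section ReductionSoundness.
Variable S : comPzSemiRingType.
Implicit Types (t u v w : term S) (s : nat -> term S) (G : nat -> proposition).
Local Notation I := (interp S).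
Local Notation M A := (@interp_module S A).

Ltac semantics :=
  invert_ltyped;
  repeat match goal with
  | H : ltyped _ _ _ |- _ => case: (fundamental H) => ? ?; clear H
  end.

(** A contracted elimination evaluates through its reduct, a sum or multiple of introductions
    evaluates to its reduct, and the commutation rules are instances of [elim_sum] and
    [elim_scal]. *)
Lemma head_red_sound G t t' A : head_red t t' -> ltyped G t A ->
  sem_eq G t t' A.
Proof.
move=> tt' tyt; have tyt' := head_red_ltyped tt' tyt.
have [et _] := fundamental tyt; have [et' _] := fundamental tyt'.
move=> s s' ss; apply: eqv_trans (et _ _ ss) _; move/related_r: ss => {s} ss.
have hh := sem_eq_halts et' ss.
have value (v : term S) u :
    is_intro u -> eval v u -> forall w, eval u w -> eval v w.
  by move=> iu vu w uw; rewrite -(eval_det (E_intro iu) uw).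
case: tt' tyt hh {tyt' et et'} => {t t'} /=.
- by move=> a t tyt; apply: halts_expand => v; apply: E_letone; constructor.
- move=> B t u tyt; rewrite subst_subst1; apply: halts_expand => v.
  by apply: E_app; constructor.
- move=> u v B C w tyt; rewrite subst_subst2; apply: halts_expand => x.
  by exact: (E_lettensor (E_intro (t := TPair _ _) isT)).
- move=> t1 t2 B v tyt; rewrite subst_subst1; apply: halts_expand => x.
  by exact: (E_letfst _ (E_intro (t := WPair _ _) isT)).
- move=> t1 t2 B v tyt; rewrite subst_subst1; apply: halts_expand => x.
  by exact: (E_letsnd _ (E_intro (t := WPair _ _) isT)).
- move=> t B v C w tyt; rewrite subst_subst1; apply: halts_expand => x.
  by exact: (E_case (E_intro (t := Inl _) isT)).
- move=> t B v C w tyt; rewrite subst_subst1; apply: halts_expand => x.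
  by exact: (E_case (E_intro (t := Inr _) isT)).
- move=> t B u tyt; rewrite subst_subst1; apply: halts_expand => x.
  by exact: (E_letbang (E_intro (t := Promote _) isT)).
- move=> a b _; apply: halts_expand; apply: value => //.
  exact: (E_sum (v := Star a) (w := Star b)) (E_intro _) (E_intro _).
- move=> B t u _; apply: halts_expand; apply: value => //.
  set r := subst _ t; set r' := subst _ u.
  have := E_sum (E_intro (t := Lam B r) isT) (E_intro (t := Lam B r') isT).
  by rewrite /=; case: proposition_eq_dec.
- move=> t u B C v tyt _; semantics.
  by apply: (elim_sum (M (Tensor B C)) (M A) (sem_lettensor_spec _ _ _ ss));
    eauto using sem_eq_halts.
- move=> _; apply: halts_expand; apply: value => //.
  exact: (E_sum (v := Unit) (w := Unit)) (E_intro _) (E_intro _).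
- move=> t u v w _; apply: halts_expand; apply: value => //.
  exact: (E_sum (v := WPair _ _) (w := WPair _ _)) (E_intro _) (E_intro _).
- move=> t u B v C w tyt _; semantics.
  by apply: (elim_sum (M (Plus B C)) (M A) (sem_case_spec _ _ _ _ ss));
    eauto using sem_eq_halts.
- move=> t u B v tyt _; semantics.
  by apply: (elim_sum (M (Bang B)) (M A) (sem_letbang_spec _ ss));
    eauto using sem_eq_halts.
- move=> a b _; apply: halts_expand; apply: value => //.
  exact: (E_scal a (v := Star b)) (E_intro _).
- move=> a B t _; apply: halts_expand; apply: value => //.
  exact: (E_scal a (v := Lam _ _)) (E_intro _).
- move=> a t B C v tyt _; semantics.
  by apply: (elim_scal a (M (Tensor B C)) (M A) (sem_lettensor_spec _ _ _ ss));
    eauto using sem_eq_halts.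
- move=> a _; apply: halts_expand; apply: value => //.
  exact: (E_scal a (v := Unit)) (E_intro _).
- move=> a t u _; apply: halts_expand; apply: value => //.
  exact: (E_scal a (v := WPair _ _)) (E_intro _).
- move=> a t B v C w tyt _; semantics.
  by apply: (elim_scal a (M (Plus B C)) (M A) (sem_case_spec _ _ _ _ ss));
    eauto using sem_eq_halts.
- move=> a t B v tyt _; semantics.
  by apply: (elim_scal a (M (Bang B)) (M A) (sem_letbang_spec _ ss));
    eauto using sem_eq_halts.
Qed.

(** Here it pays off that [sem_eq] compares two terms: reduction under a term former is an instance
    of its compatibility lemma. *)
Lemma red_sound G t t' A : red t t' -> ltyped G t A -> sem_eq G t t' A.
Proof.
move=> r; elim: r G A => {t t'} /=.
  by move=> *; eauto using head_red_sound.
all: intros; invert_ltyped;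
  match goal with
  | IH : forall G A, ltyped G ?t A -> _, H : ltyped _ ?t _ |- _ =>
      move: (IH _ _ H) => ?
  end; semantics;
  by eauto using sem_eq_sum, sem_eq_scal, sem_eq_letone, sem_eq_lam,
    sem_eq_app, sem_eq_tpair, sem_eq_lettensor,
    sem_eq_unit, sem_eq_absurd, sem_eq_wpair, sem_eq_letfst, sem_eq_letsnd,
    sem_eq_inl, sem_eq_inr, sem_eq_case, sem_eq_promote, sem_eq_letbang.
Qed.

Lemma reds_sound G t t' A : clos_refl_trans _ (@red S) t t' -> ltyped G t A ->
  ltyped G t' A /\ sem_eq G t t' A.
Proof.
elim=> {t t'} [t t' r tyt|t tyt|t u v _ IHtu _ IHuv tyt].
- by split; [exact: red_ltyped tyt | exact: red_sound].
- by split=> //; case: (fundamental tyt).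
- have [tyu etu] := IHtu tyt; have [tyv euv] := IHuv tyu; split=> //.
  move=> s s' ss; apply: eqv_trans (etu s s' ss) _.
  exact: euv (related_r ss).
Qed.

Lemma irreducible_reds t u : irreducible t -> clos_refl_trans _ (@red S) t u ->
  u = t.
Proof.
move=> + r; elim: r => {t u} // [t u r /(_ u)//|t u v _ IHtu _ IHuv it].
by have e := IHtu it; move: IHuv; rewrite e => /(_ it).
Qed.

End ReductionSoundness.

(** * Vectors *)

Section Vectors.
Variable S : comPzSemiRingType.
Implicit Types (t u v w : term S).
Local Notation I := (interp S).
Local Notation M A := (@interp_module S A).
Local Notation "t ->> u" := (clos_refl_trans _ (@red S) t u) (at level 70).

Lemma eqv_wpair A B p p' q q' : eqv (I A) p p' -> eqv (I B) q q' ->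
  eqv (I (With A B)) (WPair p q) (WPair p' q').
Proof.
move=> pp qq; have [[hp hp' _] [hq hq' _]] := (pp, qq).
split; try exact: halts_wpair.
move=> _ [phi [psi [[rphi _] [rpsi _] ->]]].
by rewrite !(evl_intro (t := WPair _ _) isT) /= (rphi _ _ pp) (rpsi _ _ qq).
Qed.

Lemma eqv_intro A t v : is_intro v -> eval t v -> halts (I A) v ->
  eqv (I A) v t.
Proof.
move=> iv tv hv; apply/eqv_sym/halts_expand => // w vw.
by rewrite -(eval_det (E_intro iv) vw).
Qed.

Lemma halts_star a : halts (I One) (Star a).
Proof. by exists (Star a); [constructor | exists a]. Qed.

Lemma halts_vec A (hA : in_V A) (u : 'rV[S]_(pdim A)) :
  halts (I A) (term_of_vec u).
Proof.
elim: hA u => [u|B C _ IHB _ IHC u]; first exact: halts_star.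
by apply: halts_wpair; [exact: IHB | exact: IHC].
Qed.

Lemma ltyped_vec G A (hA : in_V A) (u : 'rV[S]_(pdim A)) :
  ltyped G (term_of_vec u) A.
Proof. by elim: hA u => *; constructor. Qed.

Lemma fv_vec i A (hA : in_V A) (u : 'rV[S]_(pdim A)) : ~~ fv i (term_of_vec u).
Proof. by elim: hA u => //= B C _ IHB _ IHC u; rewrite negb_or IHB IHC. Qed.

(** The two sides are only equivalent: a sum of pairs evaluates to a pair of unevaluated sums, which
    the induction compares componentwise. *)
Lemma vec_add A (hA : in_V A) (u v : 'rV[S]_(pdim A)) :
  eqv (I A) (term_of_vec (u + v)) (Sum (term_of_vec u) (term_of_vec v)).
Proof.
elim: hA u v => [u v|B C hB IHB hC IHC u v].
  apply: eqv_intro (halts_star _) => //; rewrite mxE.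
  exact: (E_sum (v := Star _) (w := Star _)) (E_intro _) (E_intro _).
have el : lsubmx (u + v) = lsubmx u + lsubmx v.
  by apply/rowP => j; rewrite !mxE.
have er : rsubmx (u + v) = rsubmx u + rsubmx v.
  by apply/rowP => j; rewrite !mxE.
rewrite /= el er.
apply: eqv_trans (eqv_wpair (IHB _ _) (IHC _ _)) _.
apply: eqv_intro => //.
  exact: (E_sum (v := WPair _ _) (w := WPair _ _)) (E_intro _) (E_intro _).
by apply: halts_wpair; apply: halts_sum; try exact: interp_module;
  apply: halts_vec.
Qed.

Lemma vec_scale A (hA : in_V A) a (u : 'rV[S]_(pdim A)) :
  eqv (I A) (term_of_vec (a *: u)) (Scal a (term_of_vec u)).
Proof.
elim: hA u => [u|B C hB IHB hC IHC u].
  apply: eqv_intro (halts_star _) => //; rewrite mxE.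
  exact: (E_scal a (v := Star _)) (E_intro _).
have el : lsubmx (a *: u) = a *: lsubmx u by apply/rowP => j; rewrite !mxE.
have er : rsubmx (a *: u) = a *: rsubmx u by apply/rowP => j; rewrite !mxE.
rewrite /= el er; apply: eqv_trans (eqv_wpair (IHB _) (IHC _)) _.
apply: eqv_intro => //.
  exact: (E_scal a (v := WPair _ _)) (E_intro _).
by apply: halts_wpair; apply: halts_scal; try exact: interp_module;
  apply: halts_vec.
Qed.

(** The coordinates are observations: multiplication by [1] at [One], and at [With] an observation
    of one component extended by [0] to the other. *)
Lemma vec_inj A (hA : in_V A) (u v : 'rV[S]_(pdim A)) :
  eqv (I A) (term_of_vec u) (term_of_vec v) -> u = v.
Proof.
elim: hA u v => [u v|B C hB IHB hC IHC u v] /= uv.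
  case: uv => _ _ /(_ _ (ex_intro _ 1 erefl)).
  rewrite !(evl_intro (t := Star _) isT) !mulr1 => uv.
  by apply/rowP => j; rewrite ord1.
rewrite -[u]hsubmxK -[v]hsubmxK; congr row_mx.
  apply: IHB; split; [exact: halts_vec|exact: halts_vec|move=> k hk].
  have hk' : tst (I (With B C))
      (fun x => if x is WPair p q then k (evl p) + 0 else 0).
    exists (k \o @evl S), (fun _ => 0).
    split; [exact: (tst_linear (M B) hk) | exact: linear_on0 | by []].
  have [_ _ /(_ _ hk')] := uv.
  by rewrite !(evl_intro (t := WPair _ _) isT) !addr0.
apply: IHC; split; [exact: halts_vec|exact: halts_vec|move=> k hk].
have hk' : tst (I (With B C))
    (fun x => if x is WPair p q then 0 + k (evl q) else 0).
  exists (fun _ => 0), (k \o @evl S).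
  split; [exact: linear_on0 | exact: (tst_linear (M C) hk) | by []].
have [_ _ /(_ _ hk')] := uv.
by rewrite !(evl_intro (t := WPair _ _) isT) !add0r.
Qed.

(** Evaluation stops at a pair; the vector is reached by reducing inside the components, which halt
    because the pair is a value of [with_cand]. *)
Lemma reds_vec A (hA : in_V A) t : halts (I A) t ->
  exists2 w : 'rV[S]_(pdim A),
    t ->> term_of_vec w & eqv (I A) t (term_of_vec w).
Proof.
elim: hA t => [t [x + [a xE]]|B C hB IHB hC IHC t [x + [p [q [xE hp hq]]]]] /=;
  rewrite xE => ta.
  exists (const_mx a); rewrite /= mxE; first exact: eval_reds.
  by apply: eqv_sym; apply: (@eqv_intro One) => //; exact: halts_star.
have [v pv ev] := IHB p hp; have [w qw ew] := IHC q hq.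
exists (row_mx v w); rewrite /= row_mxKl row_mxKr.
  apply: reds_trans (eval_reds ta) _.
  apply: (@reds_trans _ _ (WPair (term_of_vec v) q)).
    by apply: (reds_ctx (f := fun x => WPair x q)) pv => *; constructor.
  by apply: (reds_ctx (f := fun x => WPair _ x)) qw => *; constructor.
apply: eqv_trans (eqv_wpair ev ew); apply: eqv_sym.
by apply: (@eqv_intro (With B C)) => //; exact: halts_wpair.
Qed.

Lemma irreducible_vec A (hA : in_V A) (u : 'rV[S]_(pdim A)) :
  irreducible (term_of_vec u).
Proof.
elim: hA u => [u t|B C _ IHB _ IHC u t] /= r.
  inversion r; subst.
  by match goal with H : head_red _ _ |- _ => inversion H end.
inversion r; subst; [|exact: (IHB _ _ H2)|exact: (IHC _ _ H2)].
by match goal with H : head_red _ _ |- _ => inversion H end.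
Qed.

Lemma vec_of_irrK A (hA : in_V A) (u : 'rV[S]_(pdim A)) :
  vec_of_irr A (term_of_vec u) = u.
Proof.
elim: hA u => [u|B C _ IHB _ IHC u] /=.
  by apply/rowP => j; rewrite mxE ord1.
by rewrite IHB IHC hsubmxK.
Qed.

Lemma app_linear_map A B t : halts (I (Lolli A B)) t ->
  linear_map (I A) (I B) (App t).
Proof.
move=> [x + [r xE lr]]; rewrite xE => tr; have [r1 r2] := lr.
have app u : halts (I A) u -> eqv (I B) (App t u) (subst1 u r).
  move=> hu; apply: halts_expand (linear_map_halts lr hu) => v.
  exact: E_app tr.
split=> [u v uv|a b u v hu hv].
  apply: eqv_trans (app u (eqv_l uv)) _.
  exact: eqv_trans (r1 _ _ uv) (eqv_sym (app v (eqv_r uv))).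
apply: eqv_trans (app _ (halts_comb (M A) a b hu hv)) _.
apply: eqv_trans (r2 a b u v hu hv) _.
by apply: (eqv_comb (M B)); apply/eqv_sym/app.
Qed.

Lemma subst_closed s t : (forall i, ~~ fv i t) -> subst s t = t.
Proof.
move=> ct; rewrite -[RHS]subst_Var; apply: eq_subst => i.
by rewrite (negbTE (ct i)).
Qed.

Lemma reds_closed t u : t ->> u -> (forall i, ~~ fv i t) -> forall i, ~~ fv i u.
Proof.
elim=> {t u} [t u r ct i|//|t u v _ IHtu _ IHuv ct]; first exact: red_fv (ct i).
exact: IHuv (IHtu ct).
Qed.

(* Closed terms do not depend on the context, so any inhabited one will do. *)
Definition ctx_One (_ : nat) : proposition := One.

Lemma sem_eq_closed t u B : (forall i, ~~ fv i t) -> (forall i, ~~ fv i u) ->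
  sem_eq ctx_One t u B -> eqv (I B) t u.
Proof.
move=> ct cu /(_ (fun _ => Star 0) (fun _ => Star 0)); rewrite !subst_closed //.
by apply=> i; apply: eqv_refl; exact: halts_star.
Qed.

Lemma eqv_vec_of A (hA : in_V A) t :
  (forall i, ~~ fv i t) -> ltyped ctx_One t A ->
  eqv (I A) t (term_of_vec (vec_of A t)).
Proof.
move=> ct tyt; have [et _] := fundamental tyt.
(* [w] only witnesses that an irreducible form exists, so that the choice made by [normal_form]
   meets its specification. *)
have [w tw _] := reds_vec hA (eqv_l (sem_eq_closed ct ct et)).
have [tn irr_n] : t ->> normal_form t /\ irreducible (normal_form t).
  apply: (epsilon_spec (inhabits t)
    (fun t' => t ->> t' /\ irreducible t')).
  by exists (term_of_vec w); split=> //; exact: (irreducible_vec hA).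
have cn := reds_closed tn ct; have [tyn etn] := reds_sound tn tyt.
have tn_eqv := sem_eq_closed ct cn etn.
(* The chosen form halts too, hence reduces to a vector; being irreducible, it is that vector. *)
have [w' nw' _] := reds_vec hA (eqv_r tn_eqv).
rewrite /vec_of; move: tn_eqv; rewrite -(irreducible_reds irr_n nw').
by rewrite (vec_of_irrK hA).
Qed.

End Vectors.

Theorem corollary2p33 (S : comPzSemiRingType) (A B : proposition)
    (hA : in_V A) (hB : in_V B)
    (f : term S) (hf : closed_proof f (Lolli A B)) :
  let F : 'rV[S]_(pdim A) -> 'rV[S]_(pdim B) :=
    fun u => vec_of B (App f (term_of_vec u)) in
  (forall u v : 'rV[S]_(pdim A), F (u + v) = F u + F v) /\
  (forall (a : S) (u : 'rV[S]_(pdim A)), F (a *: u) = a *: F u).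
Proof.
move=> F.
have look i : lookup [::] i = None by rewrite /lookup nth_nil.
have [tyf _ cf] := typed_ltyped hf (fun i => or_introl (look i)).
have {}tyf : ltyped ctx_One f (Lolli A B).
  by apply: tyf => i C; rewrite look; case.
have {}cf i : ~~ fv i f by apply: cf.
have hf' := eqv_l (sem_eq_closed cf cf (fundamental tyf).1).
have [app_eqv app_comb] := app_linear_map hf'.
have FE u : eqv (interp S B) (App f (term_of_vec u)) (term_of_vec (F u)).
  apply: eqv_vec_of => //; first by move=> i /=; rewrite negb_or cf fv_vec.
  exact: L_app tyf (ltyped_vec _ hA u).
have hV (u : 'rV[S]_(pdim A)) := halts_vec hA u.
have hW (u : 'rV[S]_(pdim B)) := halts_vec hB u.
have [MA MB] := (@interp_module S A, @interp_module S B).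
(* Additivity and homogeneity are the cases [1, 1] and [a, 0] of this statement. *)
have F_comb a b u v x : eqv (interp S A) (term_of_vec x)
    (comb a b (term_of_vec u) (term_of_vec v)) ->
  eqv (interp S B) (term_of_vec (F x))
    (comb a b (term_of_vec (F u)) (term_of_vec (F v))).
  move=> ex; apply: eqv_trans (eqv_sym (FE x)) _.
  apply: eqv_trans (app_eqv _ _ ex) _.
  apply: eqv_trans (app_comb a b _ _ (hV u) (hV v)) _.
  exact: (eqv_comb MB a b (FE u) (FE v)).
(* Observations separate vectors, so equality of vectors reduces to equivalence of the terms that
   encode them. *)
split=> [u v|a u]; apply: (vec_inj hB).
  apply: eqv_trans (eqv_sym (vec_add hB _ _)).
  apply: eqv_trans (eqv_sym (eqv_sum_comb11 MB (hW _) (hW _))).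
  apply: F_comb; apply: eqv_trans (vec_add hA _ _) _.
  exact: (eqv_sum_comb11 MA (hV u) (hV v)).
apply: eqv_trans (eqv_sym (vec_scale hB _ _)).
apply: eqv_trans (eqv_sym (eqv_scal_comb0 MB a (hW _))).
apply: F_comb; apply: eqv_trans (vec_scale hA _ _) _.
exact: (eqv_scal_comb0 MA a (hV u)).
Qed.
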